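(* Let $n\ge2$ be finite and let $P_V\subseteq G_n$ be the open set defined in the context. Then $A(P_V)$ is a maximal triangular subalgebra of $O_n$.
   Context: Fix a finite $n\ge 2$. $X=\prod_{1}^{\infty}\{1,\dots,n\}$ with the product topology. For a (possibly empty) finite string $\alpha$ in $\{1,\dots,n\}$, $\ell(\alpha)$ is its length, and $\alpha\gamma$ ($\gamma\in X$) is the concatenation. The Cuntz groupoid is $G_n=\{(\alpha\gamma,\ell(\alpha)-\ell(\beta),\beta\gamma)\mid \alpha,\beta \text{ finite strings},\ \gamma\in X\}$ with $(x,k,y)(y,j,z)=(x,k+j,z)$, $(x,k,y)^{-1}=(y,-k,x)$, and topology with basis the (compact open) sets $U_{\alpha,\beta}=\{(\alpha\gamma,\ell(\alpha)-\ell(\beta),\beta\gamma)\mid\gamma\in X\}$. The groupoid C*-algebra $C^*(G_n)$ is the completion of $C_c(G_n)$ (with convolution $f*g(x,k,y)=\sum f(x,k_1,z)g(z,k_2,y)$, the sum over $k_1+k_2=k$ and $z$ with both factors in $G_n$, and $f^*(x,k,y)=\overline{f(y,-k,x)}$) in the groupoid C*-norm. The Cuntz algebra $O_n$, generated by isometries $S_1,\dots,S_n$ with $\sum S_iS_i^*=I$, is identified with $C^*(G_n)$ so that $S_\alpha S_\beta^*$ (where $S_\alpha=S_{\alpha_1}\cdots S_{\alpha_k}$, $S_\emptyset=I$) corresponds to the characteristic function $\chi_{\alpha,\beta}$ of $U_{\alpha,\beta}$. Since the sup norm is dominated by the C*-norm, elements of $C^*(G_n)$ are viewed as continuous functions on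 $G_n$ vanishing at infinity. For an open $P\subseteq G_n$, $A(P)=\{f\in C^*(G_n)\mid f \text{ vanishes on } G_n\setminus P\}$. $D_0=\{(x,0,x)\mid x\in X\}$. A norm closed subalgebra $\mathcal T\subseteq O_n$ is triangular if its diagonal $\mathcal T\cap\mathcal T^*$ equals $A(D_0)$ (a masa in $O_n$); it is maximal triangular if it is not properly contained in any other triangular subalgebra of $O_n$. Definition of $P_V$ (orders $\prec,\preceq$ are lexicographic): an element of $G_n$ is in $P_V$ if it can be written $(\alpha\gamma,\ell(\alpha)-\ell(\beta),\beta\gamma)$ with $\alpha,\beta$ satisfying one of: (i) $\ell(\alpha)=\ell(\beta)$ and $\alpha\preceq\beta$; (ii) $\ell(\alpha)<\ell(\beta)$ and $\alpha\prec(\beta_1,\dots,\beta_{\ell(\alpha)})$; (iii) $\ell(\alpha)<\ell(\beta)$, $\alpha=(\beta_1,\dots,\beta_{\ell(\alpha)})$ and $\beta_{\ell(\alpha)+1}=\dots=\beta_{\ell(\beta)}=n$; (iv) $\ell(\alpha)>\ell(\beta)$ and $(\alpha_1,\dots,\alpha_{\ell(\beta)})\prec\beta$; (v) $\ell(\alpha)>\ell(\beta)$, $(\alpha_1,\dots,\alpha_{\ell(\beta)})=\beta$ and $\alpha_{\ell(\beta)+1}=\dots=\alpha_{\ell(\alpha)}=1$. Equivalently, $P_V$ is the union of $\{(x,k,y)\in G_n\mid x\prec y\}$ (lexicographic order on $X$), $\{(x,0,x)\mid x\in X\}$, $\{(x,k,x)\in G_n\mid k<0,\ x_j=n\text{ for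 all large }j\}$ and $\{(x,k,x)\in G_n\mid k>0,\ x_j=1\text{ for all large }j\}$. $P_V$ is open in $G_n$. *)

(* Defs.v *)
From HB Require Import structures.
From mathcomp Require Import all_boot all_order all_algebra.
From mathcomp Require Import all_classical all_reals all_analysis.
From mathcomp Require Import complex.
From mathcomp Require Import zify.

Set Implicit Arguments.
Unset Strict Implicit.
Unset Printing Implicit Defensive.

Import Order.SeqLexiOrder.Exports.
Import Order.TTheory GRing.Theory Num.Theory numFieldNormedType.Exports.

Local Open Scope classical_set_scope.
Local Open Scope ring_scope.

(* Seen through this abbreviation, R[i] gets the norm and the topology that
   numFieldNormedType puts on every numFieldType. *)
Definition Cplx (R : realType) : numClosedFieldType := R[i].

(* Norms over Cplx R take their values in Cplx R; this is the real number. *)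
Definition rnorm (R : realType) (V : normedModType (Cplx R)) (v : V) : R :=
  complex.Re `|v|.

Record cstarAlgType (K : numClosedFieldType) := CStarAlgType {
  cstar_sort :> completeNormedModType K;
  cmul : cstar_sort -> cstar_sort -> cstar_sort;
  cstar : cstar_sort -> cstar_sort;
  cmulA : associative cmul;
  cmulDl : left_distributive cmul +%R;
  cmulDr : right_distributive cmul +%R;
  cmulZl : forall (c : K) a b, cmul (c *: a) b = c *: cmul a b;
  cmulZr : forall (c : K) a b, cmul a (c *: b) = c *: cmul a b;
  cstarK : involutive cstar;
  cstarD : forall a b, cstar (a + b) = cstar a + cstar b;
  cstarZ : forall (c : K) a, cstar (c *: a) = c^* *: cstar a;
  cstarM : forall a b, cstar (cmul a b) = cmul (cstar b) (cstar a);
  cnormM : forall a b, `|cmul a b| <= `|a| * `|b|;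
  cnorm_starM : forall a, `|cmul (cstar a) a| = `|a| ^+ 2
}.

(* The inner product is linear in its first argument. *)
Record hilbertType (K : numClosedFieldType) := HilbertType {
  hilbert_sort :> completeNormedModType K;
  hdot : {dot hilbert_sort for Num.conj};
  hdot_norm : forall v, hdot v v = `|v| ^+ 2
}.

Section CuntzGroupoid.
Variable n : nat.

(* The letters 1, ..., n are the elements 0, ..., n.-1 of 'I_n, and sequences
   are indexed from 0. *)
Definition infseq := nat -> 'I_n.

(* The concatenation of a finite and an infinite string: the default value of
   nth is used exactly when size a <= i. *)
Definition strcat (a : seq 'I_n) (c : infseq) : infseq :=
  fun i => nth (c (i - size a)%N) a i.

Definition cuntz_rel (x : infseq) (k : int) (y : infseq) : Prop :=
  exists (a b : seq 'I_n) (c : infseq),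
    [/\ x = strcat a c, k = (size a)%:Z - (size b)%:Z & y = strcat b c].

Record cuntzGroupoid := CuntzGroupoid {
  gsrc : infseq;
  gdeg : int;
  gtgt : infseq;
  gmem : cuntz_rel gsrc gdeg gtgt
}.

Definition gprod (g h l : cuntzGroupoid) : Prop :=
  [/\ gtgt g = gsrc h, gsrc l = gsrc g, gdeg l = gdeg g + gdeg h &
      gtgt l = gtgt h].

Lemma cuntz_rel_sym x k y : cuntz_rel x k y -> cuntz_rel y (- k) x.
Proof.
by move=> [a [b [c [-> -> ->]]]]; exists b, a, c; split=> //; rewrite opprB.
Qed.

Definition ginv (g : cuntzGroupoid) : cuntzGroupoid :=
  CuntzGroupoid (cuntz_rel_sym (gmem g)).

Definition strpair : Type := (seq 'I_n * seq 'I_n)%type.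
HB.instance Definition _ := Choice.on strpair.
HB.instance Definition _ := isPointed.Build strpair ([::], [::]).

Definition basicU (ab : strpair) : set cuntzGroupoid :=
  [set g | exists c, [/\ gsrc g = strcat ab.1 c,
     gdeg g = (size ab.1)%:Z - (size ab.2)%:Z & gtgt g = strcat ab.2 c]].

Lemma strcat_cat a b c : strcat (a ++ b) c = strcat a (strcat b c).
Proof.
apply/funext => i; rewrite /strcat nth_cat size_cat; case: ltnP => ia.
  exact: set_nth_default.
by rewrite [RHS]nth_default// subnDA.
Qed.

Lemma strcat_inj a b c d : size a = size b -> strcat a c = strcat b d ->
  a = b /\ c = d.
Proof.
move=> sab /(congr1 (fun f => f _)) e; split.
  case: a sab e => [|x a] sab e; first by case: b sab e.
  apply: (@eq_from_nth _ x) => // i ia; have := e i; rewrite /strcat => ei.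
  rewrite (set_nth_default (c (i - size (x :: a))%N))// ei.
  by apply: set_nth_default; rewrite -sab.
apply/funext => i; have := e (size a + i)%N.
by rewrite /strcat !nth_default ?sab ?leq_addr// !addKn.
Qed.

Lemma basicU_cover : \bigcup_(ab in setT) basicU ab = setT.
Proof.
apply/seteqP; split=> // g _.
by have [a [b [c gE]]] := gmem g; exists (a, b) => //; exists c.
Qed.

Lemma basicU_sub ab ab' t : (size ab.1 <= size ab'.1)%N ->
  basicU ab t -> basicU ab' t -> basicU ab' `<=` basicU ab.
Proof.
case: ab ab' => [a b] [a' b'] /= saa' [c /= [tx tk ty]] [c' /= [tx' tk' ty']].
have sb : size b' = (size b + (size a' - size a))%N.
  by move: tk; rewrite tk'; lia.
have sbb' : (size b <= size b')%N by rewrite sb leq_addr.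
have [] : a = take (size a) a' /\ c = strcat (drop (size a) a') c'.
  apply: strcat_inj; first by rewrite size_takel.
  by rewrite -strcat_cat cat_take_drop -tx -tx'.
move=> aE cE.
have [] : b = take (size b) b' /\ c = strcat (drop (size b) b') c'.
  apply: strcat_inj; first by rewrite size_takel.
  by rewrite -strcat_cat cat_take_drop -ty -ty'.
move=> bE cE'.
have [dE _] : drop (size a) a' = drop (size b) b' /\ c' = c'.
  by apply: strcat_inj; rewrite -?cE// !size_drop sb addKn.
move=> g [d /= [gx gk gy]]; exists (strcat (drop (size a) a') d) => /=; split.
- by rewrite gx -strcat_cat [X in X ++ _]aE cat_take_drop.
- by rewrite gk -tk' tk.
- by rewrite gy dE -strcat_cat [X in X ++ _]bE cat_take_drop.
Qed.

Lemma basicU_join ab ab' t : setT ab -> setT ab' -> basicU ab t ->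
  basicU ab' t ->
  exists cd, [/\ setT cd, basicU cd t & basicU cd `<=` basicU ab `&` basicU ab'].
Proof.
move=> _ _ abt abt'; case: (leqP (size ab.1) (size ab'.1)) => [le|/ltnW le].
  by exists ab'; split=> // g gab'; split=> //; apply: (basicU_sub le abt abt').
by exists ab; split=> // g gab; split=> //; apply: (basicU_sub le abt' abt).
Qed.

HB.instance Definition _ := gen_eqMixin cuntzGroupoid.
HB.instance Definition _ := gen_choiceMixin cuntzGroupoid.
HB.instance Definition _ := @isBaseTopological.Build cuntzGroupoid
  strpair setT basicU basicU_cover basicU_join.

Definition D0 : set cuntzGroupoid :=
  [set g | gdeg g = 0 /\ gsrc g = gtgt g].

Definition all_first (s : seq 'I_n) : bool := all (fun i => val i == 0%N) s.
Definition all_last (s : seq 'I_n) : bool := all (fun i => val i == n.-1) s.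

(* Only strings of equal length are compared below. *)
Definition lex_le (a b : seq 'I_n) : bool := (a <= b :> seqlexi 'I_n)%O.
Definition lex_lt (a b : seq 'I_n) : bool := (a < b :> seqlexi 'I_n)%O.

Definition P_V : set cuntzGroupoid := [set g | exists a b c,
  [/\ gsrc g = strcat a c, gdeg g = (size a)%:Z - (size b)%:Z,
      gtgt g = strcat b c &
      [\/ size a = size b /\ lex_le a b,
          (size a < size b)%N /\ lex_lt a (take (size a) b),
          [/\ (size a < size b)%N, a = take (size a) b &
              all_last (drop (size a) b)] |
          (size b < size a)%N /\ lex_lt (take (size b) a) b \/
          [/\ (size b < size a)%N, take (size b) a = b &
              all_first (drop (size b) a)]]]].

End CuntzGroupoid.

Section GroupoidAlgebra.
Variables (R : realType) (n : nat).
Local Notation C := (Cplx R).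
Local Notation G := (cuntzGroupoid n).

(* C_c(G_n) is handled as a subset of the functions G -> C; conv, invol and the
   maps defined on C_c(G_n) are total, only their values on Cc matter. *)
Definition Cc : set (G -> C) :=
  [set f | continuous f /\ compact (closure [set g | f g != 0])].

(* The sum ranges over the factorizations l = g h; its support is finite when
   f1 and f2 are in Cc. *)
Definition conv (f1 f2 : G -> C) : G -> C := fun l =>
  \sum_(p \in [set p : G * G | gprod p.1 p.2 l]) f1 p.1 * f2 p.2.

Definition invol (f : G -> C) : G -> C := fun g => (f (ginv g))^*.

Definition is_star_rep (H : hilbertType C) (pi : (G -> C) -> {linear H -> H}) :=
  [/\ forall f, Cc f -> continuous (pi f),
      forall (c : C) f1 f2, Cc f1 -> Cc f2 ->
        forall v, pi (c *: f1 + f2) v = c *: pi f1 v + pi f2 v,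
      forall f1 f2, Cc f1 -> Cc f2 ->
        forall v, pi (conv f1 f2) v = pi f1 (pi f2 v) &
      forall f, Cc f ->
        forall v w, hdot H (pi f v) w = hdot H v (pi (invol f) w)].

Definition opnorm (H : hilbertType C) (T : H -> H) : \bar R :=
  ereal_sup [set (rnorm (T v))%:E | v in [set v | rnorm v <= 1]].

(* The groupoid C*-norm: the supremum of the norms of f in all the
   *-representations of C_c(G_n) by bounded operators on Hilbert spaces. *)
Definition groupoid_norm (f : G -> C) : \bar R :=
  ereal_sup [set z | exists (H : hilbertType C) (pi : (G -> C) -> {linear H -> H}),
    is_star_rep pi /\ z = opnorm (pi f)].

(* On together with iota is the completion of C_c(G_n) in the groupoid
   C*-norm. *)
Definition is_groupoid_cstar (On : cstarAlgType C) (iota : (G -> C) -> On) :=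
  [/\ forall (c : C) f1 f2, Cc f1 -> Cc f2 ->
        iota (c *: f1 + f2) = c *: iota f1 + iota f2,
      forall f1 f2, Cc f1 -> Cc f2 ->
        iota (conv f1 f2) = cmul (iota f1) (iota f2),
      forall f, Cc f -> iota (invol f) = cstar (iota f),
      forall f, Cc f -> (rnorm (iota f))%:E = groupoid_norm f &
      closure (iota @` Cc) = setT].

Section Subalgebras.
Variables (On : cstarAlgType C) (iota : (G -> C) -> On).

(* The function on G_n attached to a: the extension by continuity of the
   evaluations of the elements of C_c(G_n), i.e. the limit of f g as f in
   C_c(G_n) tends to a in norm. *)
Definition fun_of (a : On) : G -> C := fun g =>
  lim [set U : set C | \forall b \near a, forall f, Cc f -> iota f = b -> U (f g)].

Definition A_of (P : set G) : set On :=
  [set a | forall g, ~ P g -> fun_of a g = 0].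

Definition closed_subalgebra (T : set On) :=
  [/\ T 0, forall (c : C) a b, T a -> T b -> T (c *: a + b),
      forall a b, T a -> T b -> T (cmul a b) & closed T].

Definition triangular (T : set On) :=
  closed_subalgebra T /\ T `&` (@cstar _ On @` T) = A_of (@D0 n).

Definition maximal_triangular (T : set On) :=
  triangular T /\ forall T', triangular T' -> T `<=` T' -> T' = T.

End Subalgebras.

End GroupoidAlgebra.

(* Main.v *)
From HB Require Import structures.
From mathcomp Require Import all_boot all_order all_algebra.
From mathcomp Require Import all_classical all_reals all_analysis.
From mathcomp Require Import complex finmap summability.
From mathcomp Require Import zify ring.
Require Import Defs.

(** Below, the function of an element a of the algebra is fun_of iota a, and A(P)
    is A_of iota P.

    Triangularity.  An element of G_n belongs to P_V exactly when its source is
    lexicographically smaller than its target, or both are equal and the degree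
    is 0, negative at a point that ends in the last letter, or positive at a
    point that ends in the first letter ([P_VP]).  In this form P_V is closed
    under the groupoid product ([P_V_prod]) and meets its inverse in D_0
    ([P_V_inv]).  As the function of the adjoint of a is the conjugate of that
    of a, composed with the inversion ([fun_of_star]), the second fact gives the
    diagonal of A(P_V).  The first one makes A(P_V) an algebra: the convolution
    of two functions at l is a sum over the factorizations l = g h, and if l is
    outside P_V then g or h is outside P_V, so that every term vanishes.

    The convolution formula holds for C_c(G_n), while the elements of A(P_V) are
    only limits of such functions.  What makes the passage to the limit work is
    that rows and columns of the function of a are square-summable, with norm at
    most the norm of a ([fun_of_bessel], [fun_of_bessel_src]).  These bounds come
    from one *-representation, convolution on the square-summable functions on
    G_n ([regrep_star]): the column of f at a unit is the image of a unit vector,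
    and the groupoid norm is at least the norm of the image of f.  The same
    representation shows that evaluation at a point of G_n is contractive, hence
    that the limit defining fun_of exists ([fun_of_approx]).  The Hilbert space
    has to be constructed, and C_c(G_n) has to be shown closed under convolution;
    the latter rests on writing a function of compact support as a finite sum of
    functions supported on basic sets ([Cc_ind]), on which the source map is
    injective.

    Maximality.  Let T be triangular and contain A(P_V), and let a in T have a
    function that is nonzero outside P_V.  By continuity, and since near every
    point outside P_V there are points whose target is smaller than their source
    ([P_V_compl_dense]), this function is nonzero at some l with
    gtgt l < gsrc l.  Let s and t be initial segments of gsrc l and gtgt l that
    contain the first difference, and put b = chi s * a * chi t, an element of T.
    The function of the adjoint of b lives on points whose source starts with t
    and whose target starts with s; they are in P_V, so the adjoint of b is in
    A(P_V), hence in T.  Thus b is in the diagonal A(D_0), although its function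
    does not vanish at l, a contradiction ([A_of_P_V_maximal]). *)

Set Implicit Arguments.
Unset Strict Implicit.
Unset Printing Implicit Defensive.

Import Order.SeqLexiOrder.Exports.
Import Order.TTheory GRing.Theory Num.Theory numFieldNormedType.Exports.

Local Open Scope classical_set_scope.
Local Open Scope ring_scope.

#[local] Existing Instance totally_filter.

(** * Complex scalars *)

Section ComplexField.
Variable R : realType.
Local Notation C := (Cplx R).

Definition toC (x : R) : C := (x%:C)%C.

Lemma toC_le x y : (toC x <= toC y) = (x <= y).
Proof. exact: lecR. Qed.
Lemma toC_lt x y : (toC x < toC y) = (x < y).
Proof. exact: ltcR. Qed.

Lemma toC_Re (z : C) : 0 <= z -> toC (complex.Re z) = z.
Proof. by move=> z0; apply: RRe_real; rewrite realE z0. Qed.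

Lemma Re_le_norm (z : C) : `|toC (complex.Re z)| <= `|z|.
Proof.
rewrite normc_def [leRHS]normc_def toC_le /=.
by rewrite expr0n addr0 ler_sqrt ?addr_ge0 ?sqr_ge0// lerDl sqr_ge0.
Qed.

Lemma norm_toC (x : R) : `|toC x| = toC `|x|.
Proof. by rewrite normc_def /= expr0n addr0 sqrtr_sqr. Qed.

Lemma toCB x y : toC (x - y) = toC x - toC y.
Proof. exact: (rmorphB (real_complex R)). Qed.

Lemma toC_continuous : continuous toC.
Proof.
move=> x; apply/cvgrPdist_lt => e e0.
have e0' : 0 < complex.Re e by rewrite -toC_lt toC_Re ?ltW.
near=> y; rewrite -toCB norm_toC -(toC_Re (ltW e0)) toC_lt.
near: y; exact: cvgr_dist_lt.
Unshelve. all: by end_near. Qed.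

Lemma toC_cvg (T : Type) (F : set_system T) (f : T -> R) a : Filter F ->
  f @ F --> a -> toC (f x) @[x --> F] --> toC a.
Proof. by move=> FF fa; apply: (continuous_cvg _ (@toC_continuous a) fa). Qed.

Lemma Im_le_norm (z : C) : `|toC (complex.Im z)| <= `|z|.
Proof.
rewrite normc_def [leRHS]normc_def toC_le /=.
by rewrite expr0n addr0 ler_sqrt ?addr_ge0 ?sqr_ge0// lerDr sqr_ge0.
Qed.

Lemma toC_ReIm (z : C) : z = toC (complex.Re z) + 'i * toC (complex.Im z).
Proof. by rewrite {1}[z]complexE complexiE. Qed.

Lemma real_cauchy_map (T : Type) (F : set_system T) (p : T -> R) :
  ProperFilter F ->
  (forall e : R, 0 < e -> exists x, F [set y | `|x - p y| < e]) ->
  cvg (p @ F).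
Proof.
move=> FF Fc; apply/cauchy_cvgP/cauchy_exP => e e0.
have [x Fx] := Fc _ e0; exists x.
by rewrite -ball_normE.
Qed.

(** Completeness of the complex numbers, obtained from that of the reals on real
    and imaginary parts. *)
Lemma complex_cauchy (F : set_system C) : ProperFilter F ->
  (forall e : C, 0 < e -> exists x, F [set y | `|x - y| < e]) ->
  exists l : C, F --> l.
Proof.
move=> FF Fc.
have cR : cvg ((@complex.Re R : C -> R) @ F).
  apply: real_cauchy_map => e e0; have [|x Fx] := Fc (toC e).
    by rewrite -[0]/(toC 0) toC_lt.
  exists (complex.Re x); apply: filterS Fx => y /= xy.
  rewrite -toC_lt -norm_toC; apply: le_lt_trans xy.
  by have := Re_le_norm (x - y); rewrite raddfB.
have cI : cvg ((@complex.Im R : C -> R) @ F).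
  apply: real_cauchy_map => e e0; have [|x Fx] := Fc (toC e).
    by rewrite -[0]/(toC 0) toC_lt.
  exists (complex.Im x); apply: filterS Fx => y /= xy.
  rewrite -toC_lt -norm_toC; apply: le_lt_trans xy.
  by have := Im_le_norm (x - y); rewrite raddfB.
have /cvg_ex[a ca] := cR; have /cvg_ex[b cb] := cI.
exists (toC a + 'i * toC b).
suff : (fun z : C => toC (complex.Re z) + 'i * toC (complex.Im z)) @ F -->
    toC a + 'i * toC b.
  rewrite (_ : (fun z : C => _) = id); first by [].
  by apply/funext => z; rewrite -toC_ReIm.
apply: cvgD; first exact: toC_cvg.
by apply: cvgMl_tmp; exact: toC_cvg.
Qed.
Lemma conj_continuous : continuous (fun z : C => z^*).
Proof.
move=> x; have FF : Filter (nbhs x) by exact: nbhs_filter.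
apply/(@cvgrPdist_lt _ _ _ (nbhs x)) => e e0.
have /(@cvgrPdist_lt _ _ _ (nbhs x)) /(_ e e0) :
  id @ nbhs x --> x by exact: cvg_id.
by apply: filterS => y /=; rewrite -rmorphB norm_conjC.
Qed.
End ComplexField.

(** * The Hilbert space of square-summable families *)

Section Nets.
Variables (R : realType) (I : choiceType).
Local Notation C := (Cplx R).

(** Complex scalars are only partially ordered, so the limit is the supremum of
    the real parts. *)
Lemma monotone_net_cvg (u : {fset I} -> C) (M : C) :
  (forall S T, (S `<=` T)%fset -> u S <= u T) -> (forall S, 0 <= u S <= M) ->
  exists l : C, u @ totally --> l /\ forall S, u S <= l.
Proof.
move=> um ub; pose v S := complex.Re (u S).
have uv S : u S = toC (v S) by rewrite toC_Re//; case/andP: (ub S).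
have M0 : 0 <= M by case/andP: (ub fset0) => /le_trans h /h.
have hv : has_sup (range v).
  split; first by exists (v fset0), fset0.
  exists (complex.Re M) => _ [S _ <-]; rewrite -toC_le -uv toC_Re//.
  by case/andP: (ub S).
have vs S : v S <= sup (range v) by apply: ub_le_sup; [exact: hv.2|exists S].
exists (toC (sup (range v))); split; last by move=> S; rewrite uv toC_le.
suff vc : v @ totally --> sup (range v).
  by rewrite (funext uv); apply: toC_cvg.
apply/cvgrPdist_lt => e e0; have [_ [S _ <-] vS] := sup_adherent e0 hv.
exists S => // T /= ST; rewrite ger0_norm ?subr_ge0// ltrBlDr -ltrBlDl.
by apply: (lt_le_trans vS); rewrite -toC_le -!uv um.
Qed.

Definition sqsum (x : I -> C) (S : {fset I}) : C := \sum_(i <- S) `|x i| ^+ 2.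

Definition ell2_pred : {pred I -> C} :=
  fun x => `[< exists M, forall S, sqsum x S <= M >].

Lemma ell2P x : reflect (exists M, forall S, sqsum x S <= M) (x \in ell2_pred).
Proof. exact: asboolP. Qed.

Lemma sqsum_ge0 x S : 0 <= sqsum x S.
Proof. by apply: sumr_ge0 => i _; rewrite exprn_ge0. Qed.

Lemma sum_fset_le (F : I -> C) (S T : {fset I}) : (forall i, 0 <= F i) ->
  (S `<=` T)%fset -> \sum_(i <- S) F i <= \sum_(i <- T) F i.
Proof.
move=> F0 ST; rewrite [leRHS](big_fsetID _ (mem S)) /=.
have -> : [fset x | x in T & x \in S]%fset = S.
  by apply/fsetP => i; rewrite !inE;
    case: (boolP (i \in S)) => [/(fsubsetP ST)->|]; rewrite ?andbF.
by rewrite lerDl sumr_ge0.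
Qed.

Lemma sqsum_cvg x : x \in ell2_pred ->
  exists l : C, sqsum x @ totally --> l /\ forall S, sqsum x S <= l.
Proof.
move=> /ell2P[M xM]; apply: (@monotone_net_cvg _ M) => [S T|S].
  by apply: sum_fset_le => i; rewrite exprn_ge0.
by rewrite sqsum_ge0 xM.
Qed.

Lemma ell2_submod_closed : submod_closed ell2_pred.
Proof.
split; first by apply/ell2P; exists 0 => S; rewrite /sqsum big1// => i _;
  rewrite normr0 expr0n.
move=> a x y /ell2P[M xM] /ell2P[N yN]; apply/ell2P.
exists (2 * `|a| ^+ 2 * M + 2 * N) => S.
apply: (@le_trans _ _ (2 * `|a| ^+ 2 * sqsum x S + 2 * sqsum y S)); last first.
  by apply: lerD; apply: ler_wpM2l => //; rewrite mulr_ge0// exprn_ge0.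
rewrite /sqsum !mulr_sumr -big_split /=; apply: ler_sum => i _.
have -> : (a *: x + y) i = a * x i + y i by [].
(* by the parallelogram identity the bound exceeds the left-hand side by a square *)
rewrite -subr_ge0 (_ : _ - _ = `|a * x i - y i| ^+ 2) ?exprn_ge0//.
rewrite !normCK !rmorphD !rmorphN !rmorphM /=.
ring.
Qed.

HB.instance Definition _ := GRing.isSubmodClosed.Build _ _ ell2_pred
  ell2_submod_closed.

Record ell2 := Ell2 { ell2_fun :> I -> C; ell2_mem : ell2_fun \in ell2_pred }.

HB.instance Definition _ := [isSub for ell2_fun].
HB.instance Definition _ := [Choice of ell2 by <:].
HB.instance Definition _ := [SubChoice_isSubLmodule of ell2 by <:].

Lemma ell2_ext (x y : ell2) : (forall i, x i = y i) -> x = y.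
Proof. by move=> xy; apply: val_inj; apply/funext. Qed.

Lemma ell2DE (x y : ell2) i : (x + y) i = x i + y i. Proof. by []. Qed.
Lemma ell2ZE a (x : ell2) i : (a *: x) i = a * x i. Proof. by []. Qed.

Definition pdot (x y : ell2) (S : {fset I}) : C := \sum_(i <- S) x i * (y i)^*.

Definition edot (x y : ell2) : C := lim (pdot x y @ totally).

(** Polarization: it writes a partial inner product through monotone nets, whose
    convergence is [sqsum_cvg]. *)
Lemma pdot_sqsum x y S : pdot x y S =
  2^-1 * (sqsum (x + y) S - sqsum x S - sqsum y S) +
  'i * 2^-1 * (sqsum (x + 'i *: y) S - sqsum x S - sqsum y S).
Proof.
rewrite /sqsum -!sumrB !mulr_sumr -big_split /=; apply: eq_bigr => i _.
have -> : (val x + val y) i = x i + y i by [].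
have -> : (val x + 'i *: val y) i = x i + 'i * y i by [].
rewrite !normCK !rmorphD !rmorphM /= conjCi.
have ii : 'i ^+ 2 = -1 :> C by rewrite sqrCi.
by field: ii.
Qed.

Lemma pdot_cvg (x y : ell2) : pdot x y @ totally --> edot x y.
Proof.
apply/cvg_ex.
have [a [ca _]] := sqsum_cvg (ell2_mem x).
have [b [cb _]] := sqsum_cvg (ell2_mem y).
have [c [cc _]] := sqsum_cvg (ell2_mem (x + y)).
have [d [cd _]] := sqsum_cvg (ell2_mem (x + 'i *: y)).
exists (2^-1 * (c - a - b) + 'i * 2^-1 * (d - a - b)).
rewrite (funext (pdot_sqsum x y)).
have h (k : C) (u v w : {fset I} -> C) (p q r : C) : u @ totally --> p ->
    v @ totally --> q -> w @ totally --> r ->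
    k * (u S - v S - w S) @[S --> totally] --> k * (p - q - r).
  by move=> up vq wr; exact: (cvgMl_tmp (cvgB (cvgB up vq) wr)).
exact: (cvgD (h _ _ _ _ _ _ _ cc ca cb) (h _ _ _ _ _ _ _ cd ca cb)).
Qed.

Arguments pdot_cvg : clear implicits.

Lemma edot_lim (x y : ell2) (u : {fset I} -> C) l :
  (forall S, pdot x y S = u S) -> u @ totally --> l -> edot x y = l.
Proof.
by move=> /funext <- ul; exact: (cvg_lim (@norm_hausdorff _ _) ul).
Qed.

Lemma edotPl a x y z : edot (a *: x + y) z = a * edot x z + edot y z.
Proof.
apply: (@edot_lim _ _ (fun S => a * pdot x z S + pdot y z S)).
  move=> S; rewrite /pdot mulr_sumr -big_split; apply: eq_bigr => i _ /=.
  by rewrite [X in X * _](_ : _ = a * x i + y i)// mulrDl mulrA.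
exact: (cvgD (cvgMl_tmp (pdot_cvg x z)) (pdot_cvg y z)).
Qed.

Lemma edotC x y : edot x y = (edot y x)^*.
Proof.
apply: (@edot_lim _ _ (fun S => (pdot y x S)^*)).
  move=> S; rewrite /pdot rmorph_sum; apply: eq_bigr => i _ /=.
  by rewrite rmorphM /= conjCK mulrC.
exact: (continuous_cvg _ (@conj_continuous _ _) (pdot_cvg y x)).
Qed.

Lemma edot_sqsum_le (x : ell2) S : sqsum x S <= edot x x.
Proof.
have [a [ca xa]] := sqsum_cvg (ell2_mem x).
suff -> : edot x x = a by [].
by apply: edot_lim ca => T; apply: eq_bigr => i _; rewrite normCK.
Qed.

Lemma edot_ge0 x : 0 <= edot x x.
Proof. exact: le_trans (sqsum_ge0 x fset0) (edot_sqsum_le x _). Qed.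

Lemma edot_gt0 x : x != 0 -> 0 < edot x x.
Proof.
move=> x0; rewrite lt_def edot_ge0 andbT; apply: contra_neq x0 => xx0.
apply: ell2_ext => i; have := edot_sqsum_le x [fset i]%fset.
rewrite xx0 /sqsum big_seq_fset1 => h.
by apply/eqP; rewrite -normr_eq0 -sqrf_eq0 eq_le h exprn_ge0.
Qed.

Lemma edot_is_bilinear : @bilinear_for C ell2 ell2 C *%R (Num.conj \; *%R) edot.
Proof.
split=> [y a x z|x a y z] /=; first exact: edotPl.
by rewrite edotC edotPl rmorphD rmorphM /= -!edotC.
Qed.

HB.instance Definition _ := bilinear_isBilinear.Build C ell2 ell2 C
  *%R (Num.conj \; *%R) edot edot_is_bilinear.
HB.instance Definition _ := isHermitianSesquilinear.Build C ell2 false Num.conj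
  edot (fun x y => etrans (edotC x y) (esym (mul1r _))).
HB.instance Definition _ := isDotProduct.Build C ell2 edot edot_gt0.

Definition enorm (x : ell2) : C := sqrtC (edot x x).

Lemma edot0l w : edot 0 w = 0.
Proof. by have := edotPl (-1) 0 0 w; rewrite scaler0 addr0 mulN1r addNr. Qed.

Lemma edotZl a x w : edot (a *: x) w = a * edot x w.
Proof. by rewrite -[a *: x]addr0 edotPl edot0l addr0. Qed.

Lemma edotE_comb (a b : C) (x y : ell2) :
  edot (a *: x + b *: y) (a *: x + b *: y) =
  a * a^* * edot x x + a * b^* * edot x y + b * a^* * edot y x +
  b * b^* * edot y y.
Proof.
have l (c d : C) u v w : edot (c *: u + d *: v) w = c * edot u w + d * edot v w.
  by rewrite edotPl edotZl.
rewrite l; rewrite ![edot _ (_ + _)]edotC !l !rmorphD !rmorphM /= -!edotC.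
ring.
Qed.

(** Positivity of the form on the vector <y, y> x - <x, y> y. *)
Lemma edot_CauchySchwarz x y : `|edot x y| ^+ 2 <= edot x x * edot y y.
Proof.
have [->|y0] := eqVneq y 0.
  have -> : edot x 0 = 0 :> C by rewrite edotC edot0l conjC0.
  by rewrite normr0 expr0n mulr_ge0 ?edot_ge0.
have b0 := edot_gt0 y0.
have := edot_ge0 (edot y y *: x + (- edot x y) *: y).
rewrite edotE_comb (edotC y x) -(edotC y y) normCK rmorphN.
set b := edot y y; set a := edot x x; set d := edot x y.
rewrite (_ : _ + _ = b * (a * b - d * d^*)); last by ring.
by rewrite pmulr_rge0// subr_ge0.
Qed.

Lemma enorm_ge0 x : 0 <= enorm x.
Proof. by rewrite sqrtC_ge0 edot_ge0. Qed.

Lemma edot_le_norm x y : `|edot x y| <= enorm x * enorm y.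
Proof.
rewrite -(@ler_pXn2r _ 2)// ?nnegrE ?mulr_ge0 ?enorm_ge0// exprMn !sqrtCK.
exact: edot_CauchySchwarz.
Qed.

Lemma enormD x y : enorm (x + y) <= enorm x + enorm y.
Proof.
rewrite -(@ler_pXn2r _ 2)// ?nnegrE ?addr_ge0 ?enorm_ge0//.
have := edotE_comb 1 1 x y; rewrite !scale1r => e.
rewrite sqrrD !sqrtCK e conjC1 !mul1r -!addrA lerD2l !addrA lerD2r.
rewrite (edotC y x).
have re : edot x y + (edot x y)^* \is Num.real.
  by rewrite CrealE rmorphD /= conjCK addrC.
apply: le_trans (real_ler_norm re) _; apply: le_trans (ler_normD _ _) _.
by rewrite norm_conjC lerD ?edot_le_norm.
Qed.

Lemma enormZ (a : C) x : enorm (a *: x) = `|a| * enorm x.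
Proof.
by rewrite /enorm (dnormZ (edot :
  {dot ell2 for Num.conj})) rootCMl ?exprn_ge0// exprCK.
Qed.

Lemma enorm0_eq0 x : enorm x = 0 -> x = 0.
Proof.
by move/eqP; rewrite (sqrt_dnorm_eq0 (edot : {dot ell2 for Num.conj})) => /eqP.
Qed.

HB.instance Definition _ := @Lmodule_isNormed.Build C ell2 enorm enormD enormZ
  enorm0_eq0.

Lemma ell2_norm2 x : `|x : ell2| ^+ 2 = edot x x.
Proof. by rewrite sqrtCK. Qed.

End Nets.

(** Weak inequalities pass to the limit among nonnegative complex numbers. *)
Lemma complex_cvg_le (R : realType) (T : Type) (F : set_system T)
    (u : T -> Cplx R) (l M : Cplx R) {FF : ProperFilter F} :
  u @ F --> l -> 0 <= l -> 0 <= M -> (\forall x \near F, 0 <= u x <= M) ->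
    l <= M.
Proof.
move=> ul l0 M0 uM.
have lr : l \is Num.real by rewrite realE l0.
have Mr : M \is Num.real by rewrite realE M0.
rewrite real_leNgt//; apply/negP => Ml.
have e0 : 0 < l - M by rewrite subr_gt0.
move/cvgrPdist_lt: ul => /(_ _ e0) ul.
have [x [/andP[ux0 uxM] lx]] := filter_ex (filterI uM ul).
have ur : u x \is Num.real by rewrite realE ux0.
have := le_lt_trans (real_ler_norm (rpredB lr ur)) lx.
by rewrite ltrD2l ltrN2 => /lt_geF; rewrite uxM.
Qed.

Section Hilbert.
Variables (R : realType) (I : choiceType).
Local Notation C := (Cplx R).
Local Notation ell2 := (ell2 R I).

Lemma sqsum_le_norm (x : ell2) S : sqsum x S <= `|x| ^+ 2.
Proof. by rewrite ell2_norm2 edot_sqsum_le. Qed.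

Lemma ell2_norm_le (x : ell2) (M : C) : 0 <= M ->
  (forall S, sqsum x S <= M ^+ 2) -> `|x| <= M.
Proof.
move=> M0 xM; rewrite -(@ler_pXn2r _ 2)//;
  rewrite ?nnegrE ?normr_ge0// ell2_norm2.
apply: (complex_cvg_le (@pdot_cvg _ _ x x)); rewrite ?edot_ge0 ?exprn_ge0//.
apply: nearW => S; have -> : pdot x x S = sqsum x S.
  by apply: eq_bigr => i _; rewrite normCK.
by rewrite sqsum_ge0 xM.
Qed.

Lemma coord_le_norm (x : ell2) i : `|x i| <= `|x|.
Proof.
rewrite -(@ler_pXn2r _ 2) ?nnegrE ?normr_ge0//;
  apply: le_trans (sqsum_le_norm x [fset i]%fset).
by rewrite /sqsum big_seq_fset1.
Qed.

Lemma sum_cvg (T : Type) (F : set_system T) (s : seq I) (u : I -> T ->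
  C) (l : I -> C) {FF : Filter F} :
  (forall i, u i @ F --> l i) ->
  \sum_(i <- s) u i x @[x --> F] --> \sum_(i <- s) l i.
Proof.
move=> ul; elim: s => [|i s IH].
  under eq_fun do rewrite big_nil.
  by rewrite big_nil; exact: cvg_cst.
under eq_fun do rewrite big_cons.
by rewrite big_cons; exact: cvgD (ul i) IH.
Qed.

(** A Cauchy filter has a coordinatewise limit l.  Bounds on finite sums pass to
    this limit, so l - x is square-summable with small norm as soon as x is far
    enough in the filter, and l itself is then square-summable. *)
Lemma ell2_complete (F : set_system ell2) : ProperFilter F -> cauchy F -> cvg F.
Proof.
move=> FF /cauchyP Fc.
have {}Fc (e : C) : 0 < e -> exists x : ell2, F [set y | `|x - y| < e].
  by move=> e0; have [x] := Fc _ e0; exists x; rewrite -ball_normE in p *.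
have /choice[l lF] i : exists l : C, (fun x : ell2 => x i) @ F --> l.
  apply: complex_cauchy => e e0; have [x Fx] := Fc _ e0.
  exists (x i); change (F [set y : ell2 | `|x i - y i| < e]).
  apply: filterS Fx => y /=; apply: le_lt_trans.
  exact: (coord_le_norm (x - y) i).
have key (e : C) (x : ell2) : 0 < e -> F [set y | `|x - y| < e] ->
    forall S, sqsum (fun i => l i - x i) S <= e ^+ 2.
  move=> e0 Fx S.
  have h i : (fun y : ell2 => `|y i - x i| ^+ 2) @ F --> `|l i - x i| ^+ 2.
    have h : `|y i - x i| @[y --> F] --> `|l i - x i|.
      apply: cvg_norm; exact: (cvgB (lF i) (cvg_cst (x i))).
    under eq_fun do rewrite expr2.
    rewrite expr2; exact: (cvgM h h).
  apply: (complex_cvg_le (sum_cvg (s := enum_fset S) h)).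
  - by rewrite sqsum_ge0.
  - by rewrite exprn_ge0// ltW.
  apply: filterS Fx => y /= xy; rewrite [X in 0 <= X <= _](_ :
    _ = sqsum (y - x) S)//.
  rewrite sqsum_ge0 (le_trans (sqsum_le_norm _ _))//.
  by rewrite ler_pXn2r ?nnegrE ?(ltW e0)// distrC ltW.
have lmem : l \in @ell2_pred R I.
  have [x Fx] := Fc _ ltr01.
  have h : (fun i => l i - x i) \in @ell2_pred R I.
    by apply/ell2P; exists (1 ^+ 2); exact: (key _ _ ltr01 Fx).
  have := rpredD h (ell2_mem x).
  by rewrite (_ : _ + _ = l)//; apply/funext => i; exact: subrK.
apply/cvg_ex; exists (Ell2 lmem); apply/cvgrPdist_lt => e e0.
have e2 : 0 < e / 2 by rewrite divr_gt0.
have [x Fx] := Fc _ e2; apply: filterS (Fx) => y /= xy.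
rewrite (le_lt_trans (ler_distD x _ _))// (splitr e) ler_ltD//.
by apply: ell2_norm_le; [exact: ltW|exact: (key _ _ e2 Fx)].
Qed.

HB.instance Definition _ := Uniform_isComplete.Build ell2 ell2_complete.

Definition ell2_hilbert : hilbertType (Cplx R) :=
  @HilbertType C ell2 (@edot R I : {dot ell2 for Num.conj})
    (fun v => esym (ell2_norm2 v)).

End Hilbert.

Lemma sum_pred1_seq (V : nmodType) (I : eqType) (s : seq I) (j : I) (F :
  I -> V) :
  uniq s -> \sum_(i <- s | i == j) F i = if j \in s then F j else 0.
Proof.
move=> us; have [js|js] := boolP (j \in s).
  rewrite -big_filter filter_pred1_uniq// big_seq1//.
by rewrite big_seq_cond big1// => i /andP[iS /eqP ij]; rewrite -ij iS in js.
Qed.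

Section Delta.
Variables (R : realType) (I : choiceType).
Local Notation C := (Cplx R).
Local Notation ell2 := (ell2 R I).

Lemma edelta_mem (i : I) : (fun j => (j == i)%:R : C) \in @ell2_pred R I.
Proof.
apply/ell2P; exists 1 => S; rewrite /sqsum.
rewrite (eq_bigr (fun j => (if j == i then 1 else 0) : C)); last first.
  by move=> j _; case: eqP; rewrite ?normr1 ?normr0 ?expr1n ?expr0n.
by rewrite -big_mkcond /= sum_pred1_seq ?fset_uniq//; case: ifP.
Qed.

Definition edelta (i : I) : ell2 := Ell2 (edelta_mem i).

Definition erestr (x : ell2) (S : {fset I}) : ell2 :=
  \sum_(i <- S) x i *: edelta i.

Lemma ell2_sumE (s : seq I) (F : I -> ell2) j :
  (\sum_(i <- s) F i) j = \sum_(i <- s) F i j.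
Proof.
elim: s => [|i s IH]; first by rewrite !big_nil.
by rewrite !big_cons [LHS](_ : _ = F i j + (\sum_(k <- s) F k) j)// IH.
Qed.

Lemma erestrE x S j : erestr x S j = if j \in S then x j else 0.
Proof.
rewrite ell2_sumE (eq_bigr (fun i => if i == j then x i else 0)); last first.
  by move=> i _; rewrite ell2ZE /= eq_sym; case: eqP; rewrite ?mulr1 ?mulr0.
by rewrite -big_mkcond /= sum_pred1_seq ?fset_uniq.
Qed.

(** A finite set that carries all but e ^+ 2 of the squared norm of x leaves a
    remainder of norm at most e. *)
Lemma ell2_dense (x : ell2) (e : C) : 0 < e -> exists S, `|x - erestr x S| <= e.
Proof.
move=> e0; have [l [/cvgrPdist_lt lc xl]] := sqsum_cvg (ell2_mem x).
have /lc [S _ /(_ S (fsubset_refl _)) /= lS] : 0 < e ^+ 2 by rewrite exprn_gt0.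
exists S; apply: ell2_norm_le => [|T]; first exact: ltW.
move: lS; rewrite ger0_norm ?subr_ge0// ltrBlDr => /ltW lS.
rewrite -(lerD2r (sqsum x S)); apply: le_trans lS;
  apply: le_trans (xl (T `|` S)%fset).
set G := fun i : I => if i \in S then 0 else `|x i| ^+ 2.
set H := fun i : I => if i \in S then `|x i| ^+ 2 else 0.
have G0 i : 0 <= G i by rewrite /G; case: ifP => // _; rewrite exprn_ge0.
have H0 i : 0 <= H i by rewrite /H; case: ifP => // _; rewrite exprn_ge0.
have -> : sqsum (x - erestr x S) T = \sum_(i <- T) G i.
  apply: eq_bigr => i _; rewrite [_ i](_ : _ = x i - erestr x S i)// erestrE /G.
  by case: ifP; rewrite ?subrr ?normr0 ?expr0n ?subr0.
have -> : sqsum x S = \sum_(i <- S) H i.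
  by rewrite /sqsum big_seq [RHS]big_seq; apply: eq_bigr => i iS; rewrite /H iS.
apply: (@le_trans _ _ (\sum_(i <- (T `|` S)%fset) G i +
  \sum_(i <- (T `|` S)%fset) H i)).
  by apply: lerD; apply: sum_fset_le; rewrite ?fsubsetUl ?fsubsetUr.
rewrite -big_split; apply: ler_sum => i _ /=.
by rewrite /G /H; case: ifP; rewrite ?add0r ?addr0.
Qed.

(** Finite combinations of the basis vectors are dense. *)
Lemma bounded_linear_eq0 (phi : ell2 -> C) (M : C) : 0 <= M ->
  (forall a x y, phi (a *: x + y) = a * phi x + phi y) ->
  (forall x, `|phi x| <= M * `|x|) -> (forall i, phi (edelta i) = 0) ->
  forall x, phi x = 0.
Proof.
move=> M0 phil phiM phi0 x.
have phi00 : phi 0 = 0.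
  by have := phil (-1) 0 0; rewrite scaler0 addr0 mulN1r addNr.
have phir S : phi (erestr x S) = 0.
  rewrite /erestr; elim: (enum_fset S) => [|i s IH]; first by rewrite big_nil.
  by rewrite big_cons phil phi0 mulr0 add0r.
apply/eqP; rewrite -normr_le0; apply/ler_addgt0Pl => e e0.
have [S xS] := @ell2_dense x (e / (M + 1)) (divr_gt0 e0 (ltr_wpDl M0 ltr01)).
have -> : phi x = phi (x - erestr x S).
  by rewrite -[x - _]addrC -scaleN1r phil phir mulr0 add0r.
rewrite addr0; apply: le_trans (phiM _) _; apply: le_trans (ler_wpM2l M0 xS) _.
rewrite mulrCA ler_piMr ?(ltW e0)// ler_pdivrMr ?mul1r ?lerDl//.
exact: ltr_wpDl.
Qed.

Lemma edot_delta (x : ell2) i : edot x (edelta i) = x i.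
Proof.
have ev S : i \in S -> pdot x (edelta i) S = x i.
  move=> iS; rewrite /pdot (eq_bigr (fun j => if j == i then x j else 0)).
    by rewrite -big_mkcond /= sum_pred1_seq ?fset_uniq// iS.
  by move=> j _ /=; case: eqP; rewrite ?conjC1 ?conjC0 ?mulr1 ?mulr0.
apply: (@edot_lim _ _ _ _ (pdot x (edelta i))) => //.
apply: cvg_near_cst; exists [fset i]%fset => // S /= iS.
by apply: ev; apply: (fsubsetP iS); rewrite inE.
Qed.

(** Two bounded operators are adjoint as soon as their matrices are: this avoids
    rearranging infinite sums.  [bounded_linear_eq0] is applied twice, first in
    the second argument of the form, then in the first one. *)
Lemma adjoint_ext (T T' : {linear ell2 -> ell2}) (M M' : C) : 0 <= M ->
  0 <= M' ->
  (forall x, `|T x| <= M * `|x|) -> (forall x, `|T' x| <= M' * `|x|) ->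
  (forall i j, T (edelta j) i = (T' (edelta i) j)^*) ->
  forall x y, edot (T x) y = edot x (T' y).
Proof.
move=> M0 M0' TM TM' TT' x y.
have step1 i z : edot (edelta i) (T' z) = edot (T (edelta i)) z.
  apply/eqP; rewrite -subr_eq0 -conjC_eq0; apply/eqP.
  apply: (@bounded_linear_eq0 (fun z => (edot (edelta i) (T' z) - edot (T
    (edelta i)) z)^*)
    (enorm (edelta i) * M' + enorm (T (edelta i)))).
  - by rewrite addr_ge0 ?mulr_ge0 ?enorm_ge0.
  - move=> a u v; rewrite !rmorphB /= -!edotC linearP !edotPl; ring.
  - move=> u; rewrite norm_conjC mulrDl; apply: le_trans (ler_normB _ _) _.
    rewrite lerD ?edot_le_norm// -mulrA (le_trans (edot_le_norm _ _))//.
    exact: (ler_wpM2l (enorm_ge0 _) (TM' u)).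
  - by move=> j; rewrite edotC !edot_delta TT' subrr conjC0.
apply/eqP; rewrite -subr_eq0; apply/eqP.
apply: (@bounded_linear_eq0 (fun x => edot (T x) y - edot x (T' y))
  (M * enorm y + enorm (T' y))).
- by rewrite addr_ge0 ?mulr_ge0 ?enorm_ge0.
- by move=> a u v; rewrite linearP !edotPl; ring.
- move=> u; rewrite mulrDl; apply: le_trans (ler_normB _ _) _.
  rewrite lerD//; last by rewrite mulrC edot_le_norm.
  by rewrite (le_trans (edot_le_norm _ _))// mulrAC;
    exact: (ler_wpM2r (enorm_ge0 _) (TM u)).
- by move=> j; rewrite step1 subrr.
Qed.

End Delta.

(** * Strings, the groupoid and its basic sets *)

Section Strings.
Variable n : nat.
Local Notation X := (infseq n).
Local Notation G := (cuntzGroupoid n).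

Definition xtake (x : X) (m : nat) : seq 'I_n := mkseq x m.
Definition xdrop (x : X) (m : nat) : X := fun t => x (m + t)%N.

Lemma size_xtake x m : size (xtake x m) = m.
Proof. exact: size_mkseq. Qed.

Lemma nth_xtake d x m i : (i < m)%N -> nth d (xtake x m) i = x i.
Proof. by move=> im; rewrite nth_mkseq. Qed.

Lemma strcat_lt (a : seq 'I_n) c d i : (i < size a)%N ->
  strcat a c i = nth d a i.
Proof. by move=> ia; rewrite /strcat; exact: set_nth_default. Qed.

Lemma strcat_ge (a : seq 'I_n) c t : strcat a c (size a + t)%N = c t.
Proof. by rewrite /strcat nth_default ?leq_addr// addKn. Qed.

Lemma strcat_xtake x m : strcat (xtake x m) (xdrop x m) = x.
Proof.
apply/funext => i; rewrite /strcat size_xtake; case: (ltnP i m) => im.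
  by rewrite nth_xtake.
by rewrite nth_default ?size_xtake// /xdrop subnKC.
Qed.

Lemma strcatP (x : X) a c : x = strcat a c <->
  xtake x (size a) = a /\ xdrop x (size a) = c.
Proof.
split=> [->|[<- <-]]; last by rewrite size_xtake strcat_xtake.
split; last by apply/funext => t; rewrite /xdrop strcat_ge.
case: a => // d a; apply: (@eq_from_nth _ d); rewrite size_xtake// => i ia.
by rewrite nth_xtake// (strcat_lt _ d).
Qed.

Lemma xtake_eqP (x y : X) m :
  xtake x m = xtake y m <-> forall i, (i < m)%N -> x i = y i.
Proof.
split=> [e i im|e].
  by rewrite -(nth_xtake (x i) x im) e nth_xtake.
case: m e => // m e; apply: (@eq_from_nth _ (x 0%N));
  rewrite !size_xtake// => i im.
by rewrite !nth_xtake// e.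
Qed.

Lemma gext (g h : G) : gsrc g = gsrc h -> gdeg g = gdeg h ->
  gtgt g = gtgt h -> g = h.
Proof.
case: g h => [x k y gm] [x' k' y' gm'] /= ex ek ey; subst x' k' y'.
by rewrite (Prop_irrelevance gm gm').
Qed.

(** The relation behind [cuntz_rel], without the strings: the degree of an element
    is p - q for any such p and q, and p and q may be increased together. *)
Definition shift_rel (p q : nat) (x y : X) :=
  forall t, x (p + t)%N = y (q + t)%N.

Lemma shift_relW p q r x y : shift_rel p q x y -> shift_rel (p + r) (q + r) x y.
Proof. by move=> h t; rewrite -!addnA. Qed.

Lemma cuntz_relP (x : X) k (y : X) : cuntz_rel x k y <->
  exists p q : nat, k = p%:Z - q%:Z /\ shift_rel p q x y.
Proof.
split=> [[a [b [c [-> -> ->]]]]|[p [q [-> h]]]].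
  by exists (size a), (size b); split=> // t; rewrite !strcat_ge.
exists (xtake x p), (xtake y q), (xdrop x p).
rewrite !size_xtake strcat_xtake; split=> //.
by apply/strcatP; rewrite size_xtake; split=> //; apply/funext => t;
  rewrite /xdrop h.
Qed.

Lemma cuntz_rel0 (x : X) : cuntz_rel x 0 x.
Proof. by apply/cuntz_relP; exists 0%N, 0%N. Qed.

Lemma cuntz_rel_trans (x y z : X) k j : cuntz_rel x k y -> cuntz_rel y j z ->
  cuntz_rel x (k + j) z.
Proof.
move=> /cuntz_relP[p [q [-> h]]] /cuntz_relP[p' [q' [-> h']]].
apply/cuntz_relP; exists (p + p')%N, (q' + q)%N; split; first by lia.
by move=> t; rewrite -addnA h addnCA h' addnA.
Qed.

Definition gunit x : G := CuntzGroupoid (cuntz_rel0 x).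

Definition gmul (g h : G) (e : gtgt g = gsrc h) : G :=
  CuntzGroupoid (cuntz_rel_trans (gmem g)
    (eq_ind_r (fun y => cuntz_rel y (gdeg h) (gtgt h)) (gmem h) e)).

(** The product of g^-1 and l; the value l is a default for elements with
    different sources. *)
Definition ldiv (g l : G) : G :=
  match pselect (gtgt (ginv g) = gsrc l) with
  | left e => gmul e
  | right _ => l
  end.

Lemma ldivP (g l : G) : gsrc g = gsrc l -> [/\ gsrc (ldiv g l) = gtgt g,
  gdeg (ldiv g l) = gdeg l - gdeg g & gtgt (ldiv g l) = gtgt l].
Proof.
move=> e; rewrite /ldiv; case: pselect => // h; split=> //=.
by rewrite addrC.
Qed.

Lemma gprodP (g h l : G) : gprod g h l <-> gsrc g = gsrc l /\ h = ldiv g l.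
Proof.
split=> [[th sl dl tl]|[sl ->]]; last first.
  by have [s d t] := ldivP sl; split; rewrite ?s ?d ?t//; lia.
have [s d t] := ldivP (esym sl); split=> //.
by apply: gext; rewrite ?s ?d ?t// dl; lia.
Qed.

Lemma basicUP (a b : seq 'I_n) (g : G) : basicU (a, b) g <->
  [/\ xtake (gsrc g) (size a) = a, xtake (gtgt g) (size b) = b,
      gdeg g = (size a)%:Z - (size b)%:Z &
      shift_rel (size a) (size b) (gsrc g) (gtgt g)].
Proof.
split=> [[c /= [sg dg tg]]|[sa sb dg sh]].
  have [-> _] := (strcatP _ _ _).1 sg; have [-> _] := (strcatP _ _ _).1 tg.
  by split=> // t; rewrite sg tg !strcat_ge.
exists (xdrop (gsrc g) (size a)); split=> //=.
  by rewrite -{1}sa strcat_xtake.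
by apply/strcatP; split=> //; apply/funext => t; rewrite /xdrop sh.
Qed.

Lemma gmem_shift (g : G) : exists p q : nat,
  gdeg g = p%:Z - q%:Z /\ shift_rel p q (gsrc g) (gtgt g).
Proof. exact/cuntz_relP/gmem. Qed.

Lemma basicU_open ab : open (basicU ab : set G).
Proof.
exists [set ab]; first by [].
by rewrite bigcup_set1.
Qed.

(** A neighbourhood base at g when p and q describe g, indexed by m. *)
Definition nbase (g : G) (p q m : nat) : set G :=
  basicU (xtake (gsrc g) (p + m), xtake (gtgt g) (q + m)).

Lemma nbaseP g p q m h : gdeg g = p%:Z - q%:Z -> nbase g p q m h <->
  [/\ forall i, (i < p + m)%N -> gsrc h i = gsrc g i,
      forall i, (i < q + m)%N -> gtgt h i = gtgt g i,
      gdeg h = gdeg g &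
      shift_rel (p + m) (q + m) (gsrc h) (gtgt h)].
Proof.
move=> dg; split.
  move/basicUP; rewrite !size_xtake => -[s t d sh]; split=> //.
  - exact/xtake_eqP.
  - exact/xtake_eqP.
  - by lia.
move=> [s t d sh]; apply/basicUP; rewrite !size_xtake; split=> //.
- exact/xtake_eqP.
- exact/xtake_eqP.
- by lia.
Qed.

Lemma nbase_self g p q m : gdeg g = p%:Z - q%:Z ->
  shift_rel p q (gsrc g) (gtgt g) -> nbase g p q m g.
Proof. by move=> d sh; apply/nbaseP => //; split=> //; exact: shift_relW. Qed.

Lemma nbase_nbhs g p q m : gdeg g = p%:Z - q%:Z ->
  shift_rel p q (gsrc g) (gtgt g) -> nbhs g (nbase g p q m).
Proof.
move=> d sh; apply: open_nbhs_nbhs; split; first exact: basicU_open.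
exact: nbase_self.
Qed.

(** Two basic sets with a common point are nested. *)
Lemma nbhs_nbase g p q (A : set G) : gdeg g = p%:Z - q%:Z ->
  shift_rel p q (gsrc g) (gtgt g) -> nbhs g A ->
  exists m0, forall m, (m0 <= m)%N -> nbase g p q m `<=` A.
Proof.
move=> d sh; rewrite nbhsE => -[B [[D _ <-] [ab Dab gab]] BA].
exists (size ab.1) => m m0 h hm; apply: BA; exists ab => //.
apply: (basicU_sub (ab := ab) (t := g)); last exact: hm.
- by rewrite /= size_xtake (leq_trans m0)// leq_addl.
- by [].
- exact: nbase_self.
Qed.

Lemma basicU_clopen ab : clopen (basicU ab : set G).
Proof.
split; first exact: basicU_open.
rewrite -openC openE => g gab.
have [p [q [d sh]]] := gmem_shift g.
apply: filterS (nbase_nbhs (size ab.1) d sh) => h hg hab; apply: gab.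
apply: (basicU_sub _ hab hg); first by rewrite /= size_xtake leq_addl.
exact: nbase_self.
Qed.

End Strings.

Section Compact.
Variable n : nat.
Local Notation G := (cuntzGroupoid n).

Lemma cuntz_rel_strcat (a b : seq 'I_n) c :
  cuntz_rel (strcat a c) ((size a)%:Z - (size b)%:Z) (strcat b c).
Proof. by exists a, b, c. Qed.

Definition mkg a b c : G := CuntzGroupoid (cuntz_rel_strcat a b c).

Lemma mkg_shift a b c : shift_rel (size a) (size b) (gsrc (mkg a b c)) (gtgt
  (mkg a b c)).
Proof. by move=> t; rewrite /= !strcat_ge. Qed.

(** An ultrafilter chooses one value of a function with finitely many values. *)
Lemma ultra_fin (F : set_system G) (T : finType) (f : G -> T) : UltraFilter F ->
  exists v, F [set g | f g = v].
Proof.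
move=> FU; apply: contrapT => /forallNP nF.
have : F [set g | forall v, f g <> v].
  apply: filter_forall => v.
  by have [/nF|] := in_ultra_setVsetC [set g | f g = v] FU.
by move/filter_ex => [g /(_ (f g))].
Qed.

(** Along an ultrafilter on a basic set each letter of the common tail is
    ultimately constant; these letters are the tail of the limit. *)
Lemma basicU_compact (ab : strpair n) : compact (basicU ab : set G).
Proof.
case: ab => a b; rewrite compact_ultra => F FU Fab.
have /choice[c cF] i : exists v, F [set g : G | gsrc g (size a + i)%N = v].
  exact: ultra_fin.
exists (mkg a b c); split; first by exists c.
have dg : gdeg (mkg a b c) = (size a)%:Z - (size b)%:Z by [].
move=> A /(nbhs_nbase dg (@mkg_shift a b c))[m /(_ m (leqnn _)) mA].
have Fm : F [set g : G | forall i : 'I_m, gsrc g (size a + i)%N = c i].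
  by apply: filter_forall => i; exact: cF.
apply: filterS (filterI Fab Fm) => g [[d /= [sg dg' tg]] gm].
have cd i : (i < m)%N -> d i = c i.
  by move=> im; rewrite -(gm (Ordinal im)) sg strcat_ge.
apply: mA; apply/(nbaseP _ _ dg); split=> //= [i im|i im|t].
- rewrite sg; case: (ltnP i (size a)) => ia;
  first by rewrite !(strcat_lt _ (c 0%N)).
  by rewrite -(subnKC ia) !strcat_ge cd// ltn_subLR.
- rewrite tg; case: (ltnP i (size b)) => ib;
  first by rewrite !(strcat_lt _ (c 0%N)).
  by rewrite -(subnKC ib) !strcat_ge cd// ltn_subLR.
- by rewrite sg tg -!addnA !strcat_ge.
Qed.

End Compact.

(** * Lexicographic order and the set P_V *)

Section Lex.
Variable n : nat.
Local Notation X := (infseq n).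
Local Notation G := (cuntzGroupoid n).

Definition lexlt (x y : X) := exists m,
  (forall i, (i < m)%N -> x i = y i) /\ (x m < y m)%N.

Lemma xtakeS (x : X) m : xtake x m.+1 = x 0%N :: xtake (xdrop x 1) m.
Proof.
rewrite /xtake /mkseq /= -[in LHS](addn0 1%N) iotaDl -map_comp; congr (_ :: _).
Qed.

Lemma lex_ltP (x y : X) m : lex_lt (xtake x m) (xtake y m) <->
  exists k, [/\ (k < m)%N, forall i, (i < k)%N -> x i = y i & (x k < y k)%N].
Proof.
elim: m x y => [|m IH] x y; first by split=> // -[k []].
rewrite !xtakeS /lex_lt ltxi_cons !leEord; split.
  case/andP=> xy; case: ltngtP xy => //= [xy _ _|xy _ lt].
    by exists 0%N.
  have /IH[k [km h kk]] := lt; exists k.+1; split=> // -[|i] ik.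
    exact: val_inj.
  exact: h.
move=> [[|k] [km h kk]]; first by rewrite (ltnW kk) leqNgt kk.
rewrite h// leqnn /=; apply/IH; exists k; split=> // i ik.
exact: (h i.+1).
Qed.

Lemma lexlt_trans x y z : lexlt x y -> lexlt y z -> lexlt x z.
Proof.
move=> [m [xy xym]] [k [yz yzk]]; case: (ltngtP m k) => mk.
- exists m; split=> [i im|]; first by rewrite xy// yz// (ltn_trans im).
  by rewrite -yz.
- exists k; split=> [i im|]; first by rewrite xy// ?yz// (ltn_trans im).
  by rewrite xy.
- subst k; exists m; split=> [i im|]; first by rewrite xy// yz.
  exact: ltn_trans yzk.
Qed.

Lemma lexlt_irr x : ~ lexlt x x.
Proof. by move=> [m [_]]; rewrite ltnn. Qed.

Lemma lexlt_total x y : [\/ lexlt x y, x = y | lexlt y x].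
Proof.
have [e|ne] := pselect (forall i, x i = y i); first by constructor 2;
  exact/funext.
have /ex_minnP[m /eqP xym mmin] : exists i, x i != y i.
  by apply: contrapT => /forallNP h; apply: ne => i; apply/eqP/negP => /negP /h.
have xy i : (i < m)%N -> x i = y i.
  by move=> im; apply/eqP/negP => /negP /mmin; rewrite leqNgt im.
case: (ltngtP (x m) (y m)) => xm; last by case: xym; exact: val_inj.
  by constructor 1; exists m.
by constructor 3; exists m; split=> // i /xy.
Qed.

Lemma lexlt_strcat (a : seq 'I_n) c c' : lexlt c c' ->
  lexlt (strcat a c) (strcat a c').
Proof.
move=> [m [h hm]]; exists (size a + m)%N; split=> [i im|];
  last by rewrite !strcat_ge.
case: (ltnP i (size a)) => ia; first by rewrite !(strcat_lt _ (c 0%N)).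
by rewrite -(subnKC ia) !strcat_ge h// ltn_subLR.
Qed.

(** The comparison behind the cases of P_V where one string extends the other by
    a constant block d: the first letter of c that differs from v decides how c
    compares with d followed by c. *)
Lemma strcat_const_cases (v : nat) (d : seq 'I_n) (c : X) :
  (0 < size d)%N -> all (fun i => val i == v) d ->
  (strcat d c = c /\ forall i, val (c i) = v) \/
  exists m, [/\ forall i, (i < m)%N ->
    strcat d c i = c i, val (strcat d c m) = v &
                val (c m) <> v].
Proof.
move=> d0 /allP dv.
have sv m : (forall i, (i < m)%N -> val (c i) = v) ->
    forall i, (i <= m)%N -> val (strcat d c i) = v.
  move=> cm i im; case: (ltnP i (size d)) => id.
    by rewrite (strcat_lt _ (c 0%N))//; apply/eqP/dv/mem_nth.
  by rewrite -(subnKC id) strcat_ge cm//; lia.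
have [e|ne] := pselect (forall i, val (c i) = v); [left|right].
  by split=> //; apply/funext => i; apply: val_inj; rewrite e (sv i).
have /ex_minnP[m /eqP cm mmin] : exists i, val (c i) != v.
  by apply: contrapT => /forallNP h; apply: ne => i; apply/eqP/negP => /negP /h.
have cv i : (i < m)%N -> val (c i) = v.
  by move=> im; apply/eqP/negP => /negP /mmin; rewrite leqNgt im.
exists m; split=> // [i im|]; last exact: (sv m cv).
by apply: val_inj; rewrite cv// (sv m cv)// ltnW.
Qed.

Definition eventually_val (v : nat) (x : X) :=
  exists N, forall i, (N <= i)%N -> val (x i) = v.

Lemma eventually_val_strcat v a c : (forall i, val (c i) = v) ->
  eventually_val v (strcat a c).
Proof.
by move=> cv; exists (size a) => i ai; rewrite -(subnKC ai) strcat_ge.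
Qed.

Lemma take_xtake (x : X) p q : (p <= q)%N -> take p (xtake x q) = xtake x p.
Proof. by move=> pq; rewrite /xtake /mkseq -map_take take_iota (minn_idPl pq).
Qed.

Lemma all_drop_xtake (P : pred 'I_n) (x : X) p q :
  (forall i, (p <= i)%N -> P (x i)) -> all P (drop p (xtake x q)).
Proof.
move=> h; rewrite /xtake /mkseq -map_drop drop_iota all_map.
by apply/allP => i; rewrite mem_iota add0n => /andP[/h].
Qed.

Lemma val_lt_last (i : 'I_n) : (val i <> n.-1) -> (val i < n.-1)%N.
Proof. by move=> /= h; have := ltn_ord i; lia. Qed.

(** The description of P_V by source, target and degree.  From right to left the
    strings of the definition are initial segments long enough to contain the
    first difference, or to reach the constant part of the point. *)
Lemma P_VP (g : G) : P_V g <-> lexlt (gsrc g) (gtgt g) \/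
  (gsrc g = gtgt g /\ [\/ gdeg g = 0,
    gdeg g < 0 /\ eventually_val n.-1 (gsrc g) |
     0 < gdeg g /\ eventually_val 0 (gsrc g)]).
Proof.
split.
  move=> [a [b [c [sg dg tg]]]].
  have [pa _] := (strcatP _ _ _).1 sg; have [pb _] := (strcatP _ _ _).1 tg.
  have lt_case m : lex_lt (xtake (gsrc g) m) (xtake (gtgt g) m) ->
      lexlt (gsrc g) (gtgt g).
    by move=> /lex_ltP[k [km h hk]]; exists k.
  case=> [[sab]|[sab]|[sab aE al]|].
  - rewrite /lex_le le_eqVlt => /orP[/eqP ab|lt].
      by right; rewrite sg tg dg ab; split=> //; constructor 1; rewrite subrr.
    by left; apply: (lt_case (size a)); rewrite pa sab pb.
  - by rewrite -{1}pa -pb take_xtake ?(ltnW sab)// => /lt_case; left.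
  - have bE : b = a ++ drop (size a) b by rewrite [X in X ++ _]aE cat_take_drop.
    have d0 : (0 < size (drop (size a) b))%N by rewrite size_drop subn_gt0.
    rewrite sg tg dg bE strcat_cat.
    have [[-> cl]|[m [hm sm cm]]] := strcat_const_cases c d0 al.
      right; split=> //; constructor 2; split;
        last exact: eventually_val_strcat.
      by rewrite -bE; lia.
    left; apply: lexlt_strcat; exists m; split=> [i /hm ->//|].
    by rewrite [X in (_ < X)%N]sm val_lt_last.
  case=> [[sab]|[sab bE al]].
    by rewrite -pa take_xtake ?(ltnW sab)// -{2}pb => /lt_case; left.
  have aE : a = b ++ drop (size b) a by rewrite -[X in X ++ _]bE cat_take_drop.
  have d0 : (0 < size (drop (size b) a))%N by rewrite size_drop subn_gt0.
  rewrite sg tg dg aE strcat_cat.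
  have [[-> cl]|[m [hm sm cm]]] := strcat_const_cases c d0 al.
    right; split=> //; constructor 3; split; last exact: eventually_val_strcat.
    by rewrite -aE; lia.
  left; apply: lexlt_strcat; exists m; split=> [i /hm ->//|].
  by rewrite [X in (X < _)%N]sm lt0n; apply/eqP.
have [p [q [dg sh]]] := gmem_shift g.
have wit N : [\/ (p + N = q + N)%N /\
      lex_le (xtake (gsrc g) (p + N)) (xtake (gtgt g) (q + N)),
      (p + N < q + N)%N /\ lex_lt (xtake (gsrc g) (p +
        N)) (xtake (gtgt g) (p + N)),
      [/\ (p + N < q + N)%N, xtake (gsrc g) (p + N) = xtake (gtgt g) (p + N) &
         all_last (drop (p + N) (xtake (gtgt g) (q + N)))] |
      (q + N < p + N)%N /\ lex_lt (xtake (gsrc g) (q +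
        N)) (xtake (gtgt g) (q + N)) \/
      [/\ (q + N < p + N)%N, xtake (gsrc g) (q + N) = xtake (gtgt g) (q + N) &
         all_first (drop (q + N) (xtake (gsrc g) (p + N)))]] -> P_V g.
  move=> H; exists (xtake (gsrc g) (p + N)), (xtake (gtgt g) (q + N)),
    (xdrop (gsrc g) (p + N)).
  rewrite !size_xtake strcat_xtake; split=> //; first by rewrite dg; lia.
    apply/strcatP; rewrite size_xtake; split=> //; apply/funext => t.
    by rewrite /xdrop (@shift_relW _ _ _ N _ _ sh).
  case: H => [H|[lt H]|[lt H1 H2]|[[lt H]|[lt H1 H2]]].
  - by constructor 1.
  - by constructor 2; rewrite take_xtake ?(ltnW lt).
  - by constructor 3; rewrite take_xtake ?(ltnW lt).
  - by constructor 4; left; rewrite take_xtake ?(ltnW lt).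
  - by constructor 4; right; rewrite take_xtake ?(ltnW lt).
case=> [[m [h hm]]|[e [d0|[dn [N xN]]|[dn [N xN]]]]].
- apply: (wit m.+1).
  have lt r : (m < r)%N -> lex_lt (xtake (gsrc g) r) (xtake (gtgt g) r).
    by move=> mr; apply/lex_ltP; exists m.
  case: (ltngtP p q) => pq.
  + by constructor 2; rewrite ltn_add2r pq lt// addnS ltnS leq_addl.
  + by constructor 4; left; rewrite ltn_add2r pq lt// addnS ltnS leq_addl.
  + constructor 1; split; first by rewrite pq.
    by rewrite pq; apply: ltW; apply: lt; rewrite addnS ltnS leq_addl.
- apply: (wit 0%N); constructor 1.
  have pq : p = q by lia.
  by rewrite pq e; split=> //; exact: lexx.
- apply: (wit N); constructor 3; rewrite e; split=> //; first by lia.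
  apply: all_drop_xtake => i pi; rewrite -e xN//.
  by apply: leq_trans pi; exact: leq_addl.
- apply: (wit N); constructor 4; right; rewrite e; split=> //; first by lia.
  apply: all_drop_xtake => i pi; rewrite -e xN//.
  by apply: leq_trans pi; exact: leq_addl.
Qed.

End Lex.

Section PV.
Variable n : nat.
Hypothesis n2 : (2 <= n)%N.
Local Notation X := (infseq n).
Local Notation G := (cuntzGroupoid n).

Lemma eventually_val_inj v w (x : X) : eventually_val v x ->
  eventually_val w x -> v = w.
Proof.
by move=> [N h] [M k]; rewrite -(h (N + M)%N) ?leq_addr// k// leq_addl.
Qed.

(** Degrees of different signs cannot meet at an isotropy point, because a point
    does not end both in the first and in the last letter. *)
Lemma P_V_prod (g h l : G) : gprod g h l -> P_V g -> P_V h -> P_V l.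
Proof.
move=> [gh sl dl tl] /P_VP Pg /P_VP Ph; apply/P_VP; rewrite sl tl dl.
case: Pg => [lt|[e dg]].
  case: Ph => [lt'|[e' _]]; last by left; rewrite -e' -gh.
  by left; apply: lexlt_trans lt _; rewrite gh.
case: Ph => [lt'|[e' dh]]; first by left; rewrite e gh.
right; split; first by rewrite e gh.
rewrite -gh -e in dh.
have contra : eventually_val n.-1 (gsrc g) -> eventually_val 0 (gsrc g) ->
  False.
  by move=> h1 h2; have := eventually_val_inj h1 h2; lia.
case: dg => [->|[dg eg]|[dg eg]]; first by rewrite add0r.
- constructor 2; split=> //.
  by case: dh => [->|[dh eh]|[dh eh]]; [lia|lia|case: (contra eg eh)].
- constructor 3; split=> //.
  by case: dh => [->|[dh eh]|[dh eh]]; [lia|case: (contra eh eg)|lia].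
Qed.

Lemma P_V_inv (g : G) : P_V g -> P_V (ginv g) -> D0 g.
Proof.
move=> /P_VP Pg /P_VP /= Ph; case: Pg => [lt|[e dg]].
  case: Ph => [lt'|[e' _]]; last by move: lt; rewrite e' => /lexlt_irr.
  by case: (lexlt_irr (lexlt_trans lt lt')).
split=> //; case: Ph => [|[_ dh]]; first by rewrite e => /lexlt_irr.
rewrite -e in dh.
have contra : eventually_val n.-1 (gsrc g) -> eventually_val 0 (gsrc g) ->
  False.
  by move=> h1 h2; have := eventually_val_inj h1 h2; lia.
case: dg dh => [->//|[dg eg]|[dg eg]] [dh|[dh eh]|[dh eh]]; try lia.
  by case: (contra eg eh).
by case: (contra eh eg).
Qed.

Lemma D0_P_V (g : G) : D0 g -> P_V g.
Proof. by move=> [d e]; apply/P_VP; right; split=> //; constructor 1. Qed.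

Lemma D0_inv (g : G) : D0 g -> D0 (ginv g).
Proof. by move=> [d e]; split; rewrite /= ?d ?oppr0. Qed.

Lemma ord_last : exists i : 'I_n, val i = n.-1.
Proof. have h : (n.-1 < n)%N by lia. by exists (Ordinal h). Qed.

Lemma ord_first : exists i : 'I_n, val i = 0%N.
Proof. have h : (0 < n)%N by lia. by exists (Ordinal h). Qed.

(** Here x is fixed by replacing its initial segment of length q by that of length
    p.  Cut the common tail at a late position m where x differs from v, and
    continue with v: the two resulting points first differ where the one built on
    the segment of length p has reached v and the other one still follows x. *)
Lemma isotropy_perturb (x : X) (v : 'I_n) (p q m0 : nat) : (p < q)%N ->
  shift_rel p q x x -> ~ eventually_val (val v) x ->
  exists m (c : X), [/\ (m0 <= m)%N, forall i, (i < m)%N -> c i = x (p + i)%N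
   & let y := strcat (xtake x p) c in let z := strcat (xtake x q) c in
   [/\ forall i, (i < p + m)%N -> y i = z i,
     y (p + m)%N = v & z (p + m)%N <> v] ].
Proof.
move=> pq sh nev.
have [m [m0m xm]] : exists m, (m0 <= m)%N /\ x (p + m)%N <> v.
  apply: contrapT => /forallNP h; apply: nev; exists (p + m0)%N => i pi.
  have pi' : (p <= i)%N by lia.
  apply: contrapT => xi; apply: (h (i - p)%N); split; first by lia.
  by rewrite subnKC// => e; apply: xi; rewrite e.
pose c : X := fun i => if (i < m)%N then x (p + i)%N else v.
have cE i : (i < m)%N -> c i = x (p + i)%N by rewrite /c => ->.
exists m, c; split=> //.
have zE i : (i < q + m)%N -> strcat (xtake x q) c i = x i.
  move=> im; case: (ltnP i q) => iq.
    by rewrite (strcat_lt _ v) ?size_xtake// nth_xtake.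
  have [j ij] : exists j, i = (q + j)%N by exists (i - q)%N; rewrite subnKC.
  rewrite ij -[in LHS](size_xtake x q) size_xtake.
  rewrite -{2}(size_xtake x q) strcat_ge cE; last by lia.
  by rewrite sh.
have yE i : (i < p + m)%N -> strcat (xtake x p) c i = x i.
  move=> im; case: (ltnP i p) => ip.
    by rewrite (strcat_lt _ v) ?size_xtake// nth_xtake.
  have [j ij] : exists j, i = (p + j)%N by exists (i - p)%N; rewrite subnKC.
  by rewrite ij -{2}(size_xtake x p) strcat_ge cE//; lia.
split=> [i im||].
- by rewrite yE// zE//; lia.
- by rewrite -{2}(size_xtake x p) strcat_ge /c ltnn.
- by rewrite zE//; lia.
Qed.

Lemma nbase_mkg (g : G) p q m c : gdeg g = p%:Z - q%:Z ->
  shift_rel p q (gsrc g) (gtgt g) ->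
  (forall i, (i < m)%N -> c i = gsrc g (p + i)%N) ->
  nbase g p q m (mkg (xtake (gsrc g) p) (xtake (gtgt g) q) c).
Proof.
move=> d sh cE.
have pc (x : X) r : (forall i, (i < m)%N -> c i = x (r + i)%N) ->
    forall i, (i < r + m)%N -> strcat (xtake x r) c i = x i.
  move=> h i im; case: (ltnP i r) => ir.
    by rewrite (strcat_lt _ (x 0%N)) ?size_xtake// nth_xtake.
  have [j ij] : exists j, i = (r + j)%N by exists (i - r)%N; rewrite subnKC.
  by rewrite ij -{2}(size_xtake x r) strcat_ge h//; lia.
apply/(nbaseP _ _ d); split=> /=.
- exact: pc.
- by apply: pc => i im; rewrite -sh cE.
- by rewrite !size_xtake.
- move=> t; have := strcat_ge (xtake (gsrc g) p) c (m + t).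
  rewrite size_xtake addnA => ->.
  by have := strcat_ge (xtake (gtgt g) q) c (m + t);
    rewrite size_xtake addnA => ->.
Qed.

(** Only isotropy points of nonzero degree need an argument.  There the new tail
    given by [isotropy_perturb] ends in the last letter if the degree is negative
    and in the first letter if it is positive, which makes the target smaller. *)
Lemma P_V_compl_dense (g : G) (A : set G) : ~ P_V g -> nbhs g A ->
  exists g', A g' /\ lexlt (gtgt g') (gsrc g').
Proof.
move=> nP Ag; have [lt|e|lt] := lexlt_total (gsrc g) (gtgt g).
- by case: nP; apply/P_VP; left.
- have [p [q [d sh]]] := gmem_shift g.
  have [m0 mA] := nbhs_nbase d sh Ag.
  rewrite -e in sh.
  have nd : gdeg g <> 0 by move=> d0; apply: nP; apply/P_VP; right;
    split=> //; constructor 1.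
  case: (ltngtP p q) => pq; last by case: nd; lia.
  + have [v vl] := ord_last.
    have nev : ~ eventually_val (val v) (gsrc g).
      by rewrite vl => ev; apply: nP; apply/P_VP; right; split=> //;
        constructor 2; split=> //; lia.
    have [m [c [m0m cE /= [yz yv zv]]]] := isotropy_perturb m0 pq sh nev.
    exists (mkg (xtake (gsrc g) p) (xtake (gtgt g) q) c); split.
      by apply: (mA m m0m); apply: nbase_mkg => //; rewrite -e.
    exists (p + m)%N; rewrite /= -e; split=> [i im|]; first by rewrite yz.
    by rewrite yv vl; apply: val_lt_last; rewrite -vl => /val_inj.
  + have [v vl] := ord_first.
    have nev : ~ eventually_val (val v) (gsrc g).
      by rewrite vl => ev; apply: nP; apply/P_VP; right; split=> //;
        constructor 3; split=> //; lia.
    have sh' : shift_rel q p (gsrc g) (gsrc g) by move=> t; rewrite sh.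
    have [m [c [m0m cE /= [yz yv zv]]]] := isotropy_perturb m0 pq sh' nev.
    exists (mkg (xtake (gsrc g) p) (xtake (gtgt g) q) c); split.
      apply: (mA m m0m); apply: nbase_mkg => //; rewrite -?e// => i im.
      by rewrite cE// sh.
    exists (q + m)%N; rewrite /= -e; split=> [i im|]; first by rewrite yz.
    rewrite yv vl lt0n; apply/eqP => h; apply: zv; apply: val_inj.
    by rewrite vl.
- by exists g; split=> //; exact: nbhs_singleton.
Qed.
End PV.

(** * Convolution *)

Section Fibres.
Variable n : nat.
Local Notation X := (infseq n).
Local Notation G := (cuntzGroupoid n).

(** The element of basicU ab with source x, when x starts with the first string
    of ab. *)
Definition at_src (ab : strpair n) (x : X) : G :=
  mkg ab.1 ab.2 (xdrop x (size ab.1)).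
Definition starts (a : seq 'I_n) (x : X) : bool := xtake x (size a) == a.

Lemma at_src_src ab x : starts ab.1 x -> gsrc (at_src ab x) = x.
Proof. by move=> /eqP e; rewrite /= -{1}e strcat_xtake. Qed.

Lemma at_src_basicU ab x : basicU ab (at_src ab x).
Proof. by case: ab => a b; exists (xdrop x (size a)). Qed.

Lemma basicU_at_src ab g : basicU ab g ->
  starts ab.1 (gsrc g) /\ g = at_src ab (gsrc g).
Proof.
move=> [c [sg dg tg]]; have [pa tc] := (strcatP _ _ _).1 sg.
have sa : starts ab.1 (gsrc g) by apply/eqP.
split=> //; apply: gext; first by rewrite at_src_src.
- by rewrite dg.
- by rewrite tg /= tc.
Qed.

Lemma ldiv_ldiv (k g l : G) : gsrc g = gsrc k -> gsrc g = gsrc l ->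
  ldiv (ldiv g k) (ldiv g l) = ldiv k l.
Proof.
move=> gk gl; have [s d t] := ldivP gk; have [s' d' t'] := ldivP gl.
have ss : gsrc (ldiv g k) = gsrc (ldiv g l) by rewrite s s'.
have [s1 d1 t1] := ldivP ss; have [s2 d2 t2] := ldivP (etrans (esym gk) gl).
by apply: gext; rewrite ?s1 ?t1 ?d1 ?s2 ?t2 ?d2 ?t ?t'// d d'; lia.
Qed.

Lemma ldiv_inj (g k l : G) : gsrc g = gsrc k -> gsrc g = gsrc l ->
  ldiv g k = ldiv g l -> k = l.
Proof.
move=> gk gl e; have [s d t] := ldivP gk; have [s' d' t'] := ldivP gl.
apply: gext; first by rewrite -gk.
- by move: d; rewrite e d'; lia.
- by rewrite -t e.
Qed.

Lemma ldiv_bij (g : G) : set_bij [set k | gsrc k = gsrc g] [set h | gsrc h =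
  gtgt g]
  (ldiv g).
Proof.
split.
- by move=> k /= kg; have [-> _ _] := ldivP (esym kg).
- by move=> k l /set_mem /= kg /set_mem /= lg; apply: ldiv_inj.
- move=> h /= hg.
  have e : gsrc (ginv g) = gsrc h by rewrite hg.
  have [s d t] := ldivP e.
  have sg : gsrc g = gsrc (ldiv (ginv g) h) by rewrite s.
  exists (ldiv (ginv g) h); first by rewrite /= -sg.
  have [s' d' t'] := ldivP sg; apply: gext; rewrite ?s' ?t'//.
  by rewrite d' d /=; lia.
Qed.

End Fibres.

Section Convolution.
Variables (R : realType) (n : nat).
Local Notation C := (Cplx R).
Local Notation X := (infseq n).
Local Notation G := (cuntzGroupoid n).
Implicit Types f xi : G -> C.

Lemma convE f xi l : conv f xi l =
  \sum_(g \in [set g | gsrc g = gsrc l]) f g * xi (ldiv g l).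
Proof.
rewrite /conv (@reindex_fsbig _ _ _ _ _ (fun g => (g,
  ldiv g l)) [set g | gsrc g = gsrc l])//.
split.
- by move=> g /= gl; apply/gprodP.
- by move=> g h _ _ [].
- by move=> [g h] /= /gprodP[gl ->]; exists g.
Qed.

Lemma conv_seq f xi l (r : seq G) : uniq r -> (forall g, g \in r ->
  gsrc g = gsrc l) ->
  (forall g, gsrc g = gsrc l -> f g != 0 -> g \in r) ->
  conv f xi l = \sum_(g <- r) f g * xi (ldiv g l).
Proof.
move=> ur rl fr; rewrite convE (fsbigE r)//.
  rewrite big_seq_cond [RHS]big_seq; apply: eq_bigl => g.
  by case: (boolP (g \in r)) => //= /rl gl; rewrite mem_set.
move=> g gl; apply: contraNeq => fg; apply: fr => //.
by apply: contra_neq fg => ->; rewrite mul0r.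
Qed.

(** The algebraic half of compact support (see [CcP]); it is enough to make every
    convolution by f a finite sum. *)
Definition fincover f := exists s : seq (strpair n),
  forall g, f g != 0 -> exists2 ab, ab \in s & basicU ab g.

Definition supp_in (ab : strpair n) f := forall g, f g != 0 -> basicU ab g.

Lemma supp_in_fincover ab f : supp_in ab f -> fincover f.
Proof. by move=> fab; exists [:: ab] => g /fab; exists ab => //; rewrite inE.
Qed.

Lemma fibre_seq f : fincover f -> forall x, exists r : seq G,
  [/\ uniq r, forall g, g \in r -> gsrc g = x &
      forall g, gsrc g = x -> f g != 0 -> g \in r].
Proof.
move=> [s fs] x; exists (undup [seq at_src ab x | ab <- s & starts ab.1 x]).
split; first exact: undup_uniq.
  move=> g; rewrite mem_undup => /mapP[ab];
    rewrite mem_filter => /andP[st _] ->.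
  exact: at_src_src.
move=> g gx /fs [ab abs /basicU_at_src[st ge]].
by rewrite mem_undup; apply/mapP; exists ab; rewrite ?mem_filter -?gx ?st.
Qed.

Lemma fincover_comb (c : C) f1 f2 : fincover f1 -> fincover f2 ->
  fincover (c *: f1 + f2).
Proof.
move=> [s1 h1] [s2 h2]; exists (s1 ++ s2) => g fg.
have [f10|/h1[ab abs gab]] := eqVneq (f1 g) 0; last first.
  by exists ab => //; rewrite mem_cat abs.
have [f20|/h2[ab abs gab]] := eqVneq (f2 g) 0; last first.
  by exists ab => //; rewrite mem_cat abs orbT.
by move: fg; rewrite (_ : _ g = c * f1 g + f2 g)// f10 f20 mulr0 addr0 eqxx.
Qed.

Lemma conv_combl (c : C) f1 f2 xi : fincover f1 -> fincover f2 ->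
  conv (c *: f1 + f2) xi = c *: conv f1 xi + conv f2 xi.
Proof.
move=> h1 h2; apply/funext => l;
  rewrite [RHS](_ : _ = c * conv f1 xi l + conv f2 xi l)//.
have [r1 [u1 s1 m1]] := fibre_seq h1 (gsrc l).
have [r2 [u2 s2 m2]] := fibre_seq h2 (gsrc l).
pose r := undup (r1 ++ r2).
have ur : uniq r by exact: undup_uniq.
have rl g : g \in r -> gsrc g = gsrc l.
  by rewrite mem_undup mem_cat => /orP[/s1|/s2].
have mr1 g : gsrc g = gsrc l -> f1 g != 0 -> g \in r.
  by move=> gl f1g; rewrite mem_undup mem_cat m1.
have mr2 g : gsrc g = gsrc l -> f2 g != 0 -> g \in r.
  by move=> gl f1g; rewrite mem_undup mem_cat m2 ?orbT.
have mr g : gsrc g = gsrc l -> (c *: f1 + f2) g != 0 -> g \in r.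
  move=> gl; rewrite (_ : (_ + _) g = c * f1 g + f2 g)//.
  apply: contraNT => gr; have [f10|f1g] := eqVneq (f1 g) 0;
    last by rewrite mr1 in gr.
  have [f20|f2g] := eqVneq (f2 g) 0; last by rewrite mr2 in gr.
  by rewrite f10 f20 mulr0 addr0.
rewrite (conv_seq _ ur rl mr) (conv_seq _ ur rl mr1) (conv_seq _ ur rl mr2).
rewrite mulr_sumr -big_split; apply: eq_bigr => g _ /=.
by rewrite (_ : (_ + _) g = c * f1 g + f2 g)// mulrDl mulrA.
Qed.

Lemma conv_combr (c : C) f x1 x2 : fincover f ->
  conv f (c *: x1 + x2) = c *: conv f x1 + conv f x2.
Proof.
move=> h; apply/funext => l; rewrite [RHS](_ :
  _ = c * conv f x1 l + conv f x2 l)//.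
have [r [ur rl mr]] := fibre_seq h (gsrc l).
rewrite !(conv_seq _ ur rl mr) mulr_sumr -big_split; apply: eq_bigr => g _ /=.
by rewrite (_ : (_ + _) (ldiv g l) =
  c * x1 (ldiv g l) + x2 (ldiv g l))// mulrDr mulrCA.
Qed.

(** The source map is injective on a basic set, so the sum has one term. *)
Lemma conv_elem ab f xi l : supp_in ab f -> conv f xi l =
  if starts ab.1 (gsrc l) then f (at_src ab (gsrc l)) * xi (ldiv (at_src ab
    (gsrc l)) l) else 0.
Proof.
move=> fab; case: ifPn => st.
  rewrite (@conv_seq _ _ _ [:: at_src ab (gsrc l)])// ?big_seq1//.
    by move=> g; rewrite inE => /eqP ->; exact: at_src_src.
  by move=> g gl /fab /basicU_at_src[_ ->]; rewrite gl inE.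
rewrite (@conv_seq _ _ _ [::])// ?big_nil//.
by move=> g gl /fab /basicU_at_src[]; rewrite gl (negbTE st).
Qed.

(** Both sides sum over the factorizations with first factor in basicU ab, and
    [ldiv_bij] matches the remaining factors. *)
Lemma conv_assoc_elem ab f1 f2 xi : supp_in ab f1 ->
  conv (conv f1 f2) xi = conv f1 (conv f2 xi).
Proof.
move=> fab; apply/funext => l; rewrite [RHS](conv_elem _ _ fab) convE.
case: ifPn => st; last first.
  rewrite fsbig1// => g /= gl; rewrite (conv_elem _ _ fab) gl (negbTE st).
  by rewrite mul0r.
set phi := at_src ab (gsrc l); have sphi :
  gsrc phi = gsrc l by exact: at_src_src.
have [s d t] := ldivP sphi.
rewrite convE s (@reindex_fsbig _ _ _ _ _ _ _ _ _ (ldiv_bij phi)) sphi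
  mulr_fsumr.
apply: eq_fsbigr => k /set_mem /= kl.
rewrite (conv_elem _ _ fab) kl st -/phi -mulrA; congr (_ * (_ * xi _)).
by rewrite ldiv_ldiv// sphi.
Qed.

Definition deltaf (j : G) : G -> C := fun l => (l == j)%:R.

(** The matrix of the convolution by f: the entry at i and j is f at the product
    of i and the inverse of j. *)
Lemma conv_delta f j i : conv f (deltaf j) i =
  if `[< gtgt i = gtgt j >] then f (ldiv (ginv i) (ginv j)) else 0.
Proof.
rewrite convE; case: asboolP => tij; last first.
  rewrite fsbig1// => g /= gi; rewrite /deltaf; case: eqP;
    rewrite ?mulr0// => e.
  by case: tij; rewrite -e; have [_ _ ->] := ldivP gi.
have e : gsrc (ginv i) = gsrc (ginv j) by [].
have [s d t] := ldivP e.
have si : gsrc (ldiv (ginv i) (ginv j)) = gsrc i by rewrite s.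
have [s' d' t'] := ldivP si.
have dj : ldiv (ldiv (ginv i) (ginv j)) i = j.
  by apply: gext; rewrite ?s' ?t' ?t// d' d /=; lia.
rewrite (fsbigE [:: ldiv (ginv i) (ginv j)])//=.
- by rewrite big_cons big_nil mem_set// /deltaf dj eqxx mulr1 addr0.
- by move=> g /=; rewrite inE => /eqP ->.
move=> g /= gi; rewrite inE /deltaf => gk; case: eqP; rewrite ?mulr0// => gj.
case/eqP: gk; have [s2 d2 t2] := ldivP gi; rewrite gj in s2 d2 t2.
by apply: gext; rewrite ?s ?d ?t ?gi//= d2; lia.
Qed.

End Convolution.

(** * Functions of compact support *)

Section Cc.
Variables (R : realType) (n : nat).
Local Notation C := (Cplx R).
Local Notation X := (infseq n).
Local Notation G := (cuntzGroupoid n).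
Implicit Types f xi : G -> C.

(** Basic sets are compact and open. *)
Lemma CcP f : Cc f <-> continuous f /\ fincover f.
Proof.
split=> [[fc fK]|[fc [s fs]]]; split=> //.
  move: fK => /compact_near_coveringP /(_ _ totally
    (fun (D : {fset strpair n}) g => exists2 ab, ab \in D & basicU ab g)).
  case=> [g _|D _ /(_ D (fsubset_refl _)) h]; last first.
    exists (enum_fset D) => g fg; apply: h; exact: subset_closure.
  have [ab _ gab] : (\bigcup_(ab in setT) basicU ab) g by rewrite basicU_cover.
  exists (basicU ab, [set D : {fset strpair n} | ab \in D]) => /=.
    split; first by apply: open_nbhs_nbhs; split=> //; exact: basicU_open.
    by exists [fset ab]%fset => // D /= /fsubsetP; apply; rewrite inE.
  by move=> [h D] /= [hab abD]; exists ab.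
have KU : compact (\bigcup_(ab in [set` s]) basicU ab : set G).
  rewrite bigcup_seq; elim: s {fs} => [|ab s IH]; first by rewrite big_nil;
    exact: compact0.
  by rewrite big_cons; apply: compactU => //; exact: basicU_compact.
have cU : closed (\bigcup_(ab in [set` s]) basicU ab : set G).
  by apply: closed_bigcup => //; [exact: finite_seq|move=> ab _;
    exact: (basicU_clopen ab).2].
apply: (subclosed_compact _ KU); first exact: closed_closure.
rewrite [X in _ `<=` X]((closure_id _).1 cU); apply: closure_subset => g fg.
by have [ab abs gab] := fs g fg; exists ab.
Qed.

Lemma cvg_near_eq (f1 f2 : G -> C) (g : G) :
  (\forall h \near g, f1 h = f2 h) -> {for g, continuous f1} ->
    {for g, continuous f2}.
Proof.
move=> e f1c; have eg : f1 g = f2 g by exact: (nbhs_singleton e).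
rewrite /prop_for /continuous_at -eg => A Ag.
change (nbhs g (f2 @^-1` A)).
have Ag' : nbhs g (f1 @^-1` A) by exact: f1c.
apply: filterS (filterI e Ag') => h [eh].
by rewrite /preimage /= -eh.
Qed.

Definition cutoff (ab : strpair n) f : G ->
  C := fun g => if `[< basicU ab g >] then f g else 0.

Lemma cutoff_continuous ab f : continuous f -> continuous (cutoff ab f).
Proof.
move=> fc g; have [oU cU] := @basicU_clopen n ab.
have [gab|gab] := pselect (basicU ab g).
  apply: (@cvg_near_eq f); last exact: fc.
  have : nbhs g (basicU ab : set G) by apply: open_nbhs_nbhs; split.
  by apply: filterS => h hab; rewrite /cutoff asboolT.
apply: (@cvg_near_eq (fun=> 0)); last exact: (@cst_continuous G C 0 _).
have : nbhs g (~` basicU ab : set G).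
  by apply: open_nbhs_nbhs; split => //; rewrite openC.
by apply: filterS => h hab; rewrite /cutoff asboolF.
Qed.

Lemma cutoff_supp ab f : supp_in ab (cutoff ab f).
Proof. by move=> g; rewrite /cutoff; case: asboolP => //; rewrite eqxx. Qed.

Lemma Cc_elem ab f : continuous f -> supp_in ab f -> Cc f.
Proof. by move=> fc fab; apply/CcP; split=> //; exact: supp_in_fincover fab.
Qed.

Lemma Cc_comb (c : C) f1 f2 : Cc f1 -> Cc f2 -> Cc (c *: f1 + f2).
Proof.
move=> /CcP[c1 h1] /CcP[c2 h2]; apply/CcP; split; last exact: fincover_comb.
by move=> g; exact: (cvgD (cvgMl_tmp (c1 g)) (c2 g)).
Qed.

(** C_c(G_n) is spanned by the functions supported on one basic set: cut a function
    along the clopen basic sets that cover its support, one after the other.  The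
    sum is written with a scalar to fit the linearity lemmas. *)
Lemma Cc_ind (P : (G -> C) -> Prop) :
  (forall ab f, continuous f -> supp_in ab f -> P f) ->
  (forall f1 f2, Cc f1 -> Cc f2 -> P f1 -> P f2 -> P (1 *: f1 + f2)) ->
  forall f, Cc f -> P f.
Proof.
move=> Pe PD f /CcP[fc [s fs]].
elim: s f fc fs => [|ab s IH] f fc fs.
  by apply: (Pe ([::], [::])) => // g /fs [].
have fE : f = 1 *: cutoff ab f + (1 *: f + (-1) *: cutoff ab f).
  by rewrite !scale1r scaleN1r addrC subrK.
have c2 : continuous (1 *: f + (-1) *: cutoff ab f).
  move=> g; exact: (cvgD (cvgMl_tmp (fc g)) (cvgMl_tmp (@cutoff_continuous ab f
    fc g))).
have s2 g : (1 *: f + (-1) *: cutoff ab f) g != 0 ->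
  exists2 cd, cd \in s & basicU cd g.
  rewrite (_ : (_ + _) g = f g - cutoff ab f g); last first.
    by rewrite scale1r scaleN1r.
  rewrite /cutoff; case: asboolP; first by rewrite subrr eqxx.
  move=> gab; rewrite subr0 => /fs [cd]; rewrite inE => /orP[/eqP ->//|cds gcd].
  by exists cd.
rewrite fE; apply: PD.
- apply: (@Cc_elem ab); [exact: cutoff_continuous|exact: cutoff_supp].
- by apply/CcP; split=> //; exists s.
- apply: (Pe ab); [exact: cutoff_continuous|exact: cutoff_supp].
- exact: IH.
Qed.

Lemma Cc_invol f : Cc f -> Cc (invol f).
Proof.
move=> /CcP[fc [s fs]]; apply/CcP; split; last first.
  exists [seq (ab.2, ab.1) | ab <- s] => g;
    rewrite /invol conjC_eq0 => /fs [[a b] abs].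
  move=> [c [/= sg dg tg]]; exists (b, a); first by apply/mapP; exists (a, b).
  by exists c; split=> //=; lia.
move=> g; rewrite /invol.
have gi : (@ginv n : G -> G) @ g --> ginv g.
  move=> A; have [p [q [d sh]]] := gmem_shift g.
  have d' : gdeg (ginv g) = q%:Z - p%:Z by rewrite /= d; lia.
  have sh' : shift_rel q p (gsrc (ginv g)) (gtgt (ginv g)) by move=> t;
    rewrite /= sh.
  move=> /(nbhs_nbase d' sh')[m /(_ m (leqnn _)) mA].
  apply: filterS (nbase_nbhs m d sh) => h /(nbaseP _ _ d)[h1 h2 h3 h4] /=.
  apply: mA; apply/(nbaseP _ _ d'); split=> //=; first by rewrite h3.
exact: (continuous_cvg _ (@conj_continuous R _) (continuous_cvg _ (fc _) gi)).
Qed.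

(** Both factors of a factorization with first factor in basicU ab depend
    continuously on the product.  All three neighbourhood bases are taken with
    indices enlarged by the lengths of the strings of ab, so that a single m
    serves them. *)
Lemma at_src_cvg ab (l0 : G) : starts ab.1 (gsrc l0) ->
  (fun l : G => at_src ab (gsrc l)) @ l0 --> at_src ab (gsrc l0) /\
  (fun l : G => ldiv (at_src ab (gsrc l)) l) @ l0 -->
    ldiv (at_src ab (gsrc l0)) l0 /\
  \forall l \near l0, starts ab.1 (gsrc l).
Proof.
move=> st0; have [p0 [q0 [d0 sh0]]] := gmem_shift l0.
set a := size ab.1; set b := size ab.2.
pose p := (p0 + a)%N; pose q := (q0 + a)%N.
have d : gdeg l0 = p%:Z - q%:Z by rewrite d0 /p /q; lia.
have sh : shift_rel p q (gsrc l0) (gtgt l0) by exact: shift_relW.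
have st m l : nbase l0 p q m l -> starts ab.1 (gsrc l).
  move=> /(nbaseP _ _ d)[h1 _ _ _]; rewrite /starts -(eqP st0); apply/eqP.
  rewrite size_xtake; apply/xtake_eqP => i ia; apply: h1.
  by rewrite /p -/a in ia *; lia.
have tphi (x y : X) m : (forall i, (i < p + m)%N -> x i = y i) ->
    forall i, (i < b + p0 + m)%N -> gtgt (at_src ab x) i = gtgt (at_src ab y) i.
  move=> xy i im /=; case: (ltnP i b) => ib;
    first by rewrite !(strcat_lt _ (x 0%N)).
  have [j ij] : exists j, i = (b + j)%N by exists (i - b)%N; rewrite subnKC.
  by rewrite ij !strcat_ge /xdrop xy// /p -/a; lia.
split; [|split].
- move=> A; have dphi : gdeg (at_src ab (gsrc l0)) = p%:Z - (b + p0)%N%:Z.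
    by rewrite /= /p; lia.
  have shphi : shift_rel p (b + p0) (gsrc (at_src ab (gsrc l0))) (gtgt (at_src
    ab (gsrc l0))).
    by rewrite /p addnC; apply: shift_relW; exact: mkg_shift.
  move=> /(nbhs_nbase dphi shphi)[m /(_ m (leqnn _)) mA].
  apply: filterS (nbase_nbhs m d sh) => l ll; have stl := st _ _ ll.
  move: ll => /(nbaseP _ _ d)[h1 h2 h3 h4] /=.
  apply: mA; apply/(nbaseP _ _ dphi); split=> //.
  + by move=> i im; rewrite !at_src_src// h1.
  + by move=> i im; apply: (tphi _ _ m).
  + move=> t; rewrite /= (_ : p + m + t = a + (p0 + m + t))%N;
    last by rewrite /p; lia.
    by rewrite -!addnA !strcat_ge.
- move=> A; have [s1 d1 t1] := ldivP (at_src_src st0).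
  have dpsi : gdeg (ldiv (at_src ab (gsrc l0)) l0) = (b + p0)%N%:Z - q%:Z.
    by rewrite d1 d /p /= -/a -/b; lia.
  have shpsi : shift_rel (b + p0) q (gsrc (ldiv (at_src ab (gsrc l0)) l0))
      (gtgt (ldiv (at_src ab (gsrc l0)) l0)).
    rewrite s1 t1 => t; rewrite /= -addnA strcat_ge /xdrop -sh;
      congr (gsrc l0 _).
    by rewrite /p -/a; lia.
  move=> /(nbhs_nbase dpsi shpsi)[m /(_ m (leqnn _)) mA].
  apply: filterS (nbase_nbhs m d sh) => l ll; have stl := st _ _ ll.
  have [s2 d2 t2] := ldivP (at_src_src stl).
  move: ll => /(nbaseP _ _ d)[h1 h2 h3 h4] /=.
  apply: mA; apply/(nbaseP _ _ dpsi); split;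
    rewrite ?s1 ?s2 ?d1 ?d2 ?t1 ?t2 ?h3//.
  + by move=> i im; apply: (tphi _ _ m).
  + move=> t; rewrite /= -!addnA strcat_ge /xdrop.
    by have := h4 t; rewrite /q -!addnA => <-; congr (gsrc l _);
      rewrite /p -/a; lia.
- by apply: filterS (nbase_nbhs 0 d sh) => l /st.
Qed.

Lemma nstarts_near (a : seq 'I_n) (l0 : G) : ~~ starts a (gsrc l0) ->
  \forall l \near l0, ~~ starts a (gsrc l).
Proof.
move=> st0; have [p [q [d sh]]] := gmem_shift l0.
apply: filterS (nbase_nbhs (size a) d sh) => l /(nbaseP _ _ d)[h1 _ _ _].
apply: contraNN st0 => /eqP st; rewrite /starts -[X in _ == X]st;
  apply/eqP/xtake_eqP.
by move=> i ia; rewrite h1//; lia.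
Qed.

Lemma conv_elem_continuous ab f xi : continuous f -> supp_in ab f ->
  continuous xi ->
  continuous (conv f xi).
Proof.
move=> fc fab xic l0; have [st|st] := boolP (starts ab.1 (gsrc l0)).
  have [c1 [c2 nst]] := at_src_cvg st.
  apply: (@cvg_near_eq (fun l => f (at_src ab (gsrc l)) * xi (ldiv (at_src ab
    (gsrc l)) l))).
    by apply: filterS nst => l stl; rewrite (conv_elem _ _ fab) stl.
  exact: (cvgM (continuous_cvg _ (fc _) c1) (continuous_cvg _ (xic _) c2)).
apply: (@cvg_near_eq (fun=> 0)); last exact: (@cst_continuous G C 0 _).
by apply: filterS (nstarts_near st) => l stl;
  rewrite (conv_elem _ _ fab) (negbTE stl).
Qed.

(** The product of basicU (a, b) and basicU (c, d) is empty unless one of b and c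
    extends the other; the two listed basic sets correspond to the two cases. *)
Lemma conv_elem_fincover ab cd f xi : supp_in ab f -> supp_in cd xi ->
  fincover (conv f xi).
Proof.
case: ab cd => a b [c d] fab xicd.
exists [:: (a ++ drop (size b) c, d); (a, d ++ drop (size c) b)] => l.
rewrite (conv_elem _ _ fab) /=; case: ifPn => st; last by rewrite eqxx.
set phi := at_src _ _; have sphi : gsrc phi = gsrc l by exact: at_src_src.
rewrite mulf_eq0 negb_or => /andP[_ /xicd [z [/=]]].
have [-> -> ->] := ldivP sphi; rewrite /= => tz dz lz.
have dphi : gdeg phi = (size a)%:Z - (size b)%:Z by [].
have sl : gsrc l = strcat a (xdrop (gsrc l) (size a)).
  by rewrite -[LHS]sphi.
have [bc|cb] := leqP (size b) (size c).
- exists (a ++ drop (size b) c, d); first by rewrite inE eqxx.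
  have [e1 e2] : b = take (size b) c /\ xdrop (gsrc l) (size a) =
    strcat (drop (size b) c) z.
    apply: strcat_inj; first by rewrite size_takel.
    by rewrite -strcat_cat cat_take_drop.
  exists z => /=; rewrite lz size_cat size_drop; split=> //; last by lia.
  by rewrite strcat_cat -e2.
- exists (a, d ++ drop (size c) b); first by rewrite !inE eqxx orbT.
  have [e1 e2] : c = take (size c) b /\ z =
    strcat (drop (size c) b) (xdrop (gsrc l) (size a)).
    apply: strcat_inj; first by rewrite size_takel// ltnW.
    by rewrite -strcat_cat cat_take_drop.
  exists (xdrop (gsrc l) (size a)) => /=; rewrite size_cat size_drop;
    split=> //; first by lia.
  by rewrite strcat_cat -e2.
Qed.

Lemma Cc_fincover f : Cc f -> fincover f.
Proof. by move=> /CcP[]. Qed.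

Lemma Cc_conv f xi : Cc f -> Cc xi -> Cc (conv f xi).
Proof.
move=> fC xiC; move: f fC; apply: Cc_ind => [ab f fc fab|f1 f2 C1 C2 h1 h2];
  last first.
  by rewrite conv_combl; [exact: Cc_comb|exact: Cc_fincover|exact: Cc_fincover].
move: xi xiC; apply: Cc_ind => [cd xi xic xicd|f1 f2 C1 C2 h1 h2]; last first.
  rewrite conv_combr; first exact: Cc_comb.
  exact: supp_in_fincover fab.
apply/CcP; split; first exact: conv_elem_continuous fab xic.
exact: conv_elem_fincover fab xicd.
Qed.

Lemma conv_assoc f1 f2 xi : Cc f1 -> Cc f2 ->
  conv (conv f1 f2) xi = conv f1 (conv f2 xi).
Proof.
move=> C1 C2; move: f1 C1; apply: Cc_ind => [ab f fc fab|f f' Cf Cf' h h'].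
  exact: conv_assoc_elem fab.
have cC : forall g, Cc g -> fincover (conv g f2).
  by move=> g Cg; apply: Cc_fincover; exact: Cc_conv.
rewrite !conv_combl ?h ?h'//; try exact: Cc_fincover; exact: cC.
Qed.

End Cc.

(** * The regular representation *)

Section Representation.
Variables (R : realType) (n : nat).
Local Notation C := (Cplx R).
Local Notation G := (cuntzGroupoid n).
Local Notation H := (ell2 R G).
Implicit Types f : G -> C.

(** The vector y is quantified rather than computed, since conv f x is at first
    only a function. *)
Definition conv_bounded f (M : C) := 0 <= M /\ forall x : H, exists y : H,
  (forall l, y l = conv f x l) /\ `|y| <= M * `|x|.

(** The supremum of the norm is taken with the compactness of the basic set, in
    the form of near-covering, applied to the sets where the norm is at most M. *)
Lemma elem_bounded ab f : continuous f -> supp_in ab f ->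
  exists M : C, 0 <= M /\ forall g, `|f g| <= M.
Proof.
move=> fc fab.
have /compact_near_coveringP cov := @basicU_compact n ab.
have [g _|M [/= M0 fM]] := filter_ex (F := pinfty_nbhs C) (filterI
  (nbhs_pinfty_gt (rpred0 _)) (cov _ (pinfty_nbhs C) (fun M g => `|f g| <=
    M) _ _)).
  have fr : `|f g| + 1 \is Num.real by rewrite ger0_real ?addr_ge0.
  exists ([set h | `|f g - f h| < 1], [set M | `|f g| + 1 < M]) => /=.
    split; last exact: nbhs_pinfty_gt.
    by have /cvgrPdist_lt := fc g; apply.
  move=> [h M] /= [gh gM]; apply: le_trans (ltW gM).
  rewrite -[f h](subrK (f g)) (le_trans (ler_normD _ _))// addrC lerD2l.
  by rewrite distrC ltW.
exists M; split=> [|g]; first exact: ltW.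
have [->|fg] := eqVneq (f g) 0; first by rewrite normr0 ltW.
exact/fM/fab.
Qed.

(** Convolution by f is a weighted partial translation: it moves the value at
    psi l to l, and psi is injective. *)
Lemma conv_bounded_elem ab f : continuous f -> supp_in ab f ->
  exists M, conv_bounded f M.
Proof.
move=> fc fab; have [M [M0 fM]] := elem_bounded fc fab.
exists M; split=> // x.
pose psi l := ldiv (at_src ab (gsrc l)) l.
have key S : sqsum (conv f x) S <= (M * `|x|) ^+ 2.
  pose S' := [fset l in S | starts ab.1 (gsrc l)]%fset.
  have psi_inj : {in S' &, injective psi}.
    move=> k l; rewrite !inE => /andP[_ stk] /andP[_ stl] e.
    have [s1 d1 t1] := ldivP (at_src_src stk);
      have [s2 d2 t2] := ldivP (at_src_src stl).
    have sE : gsrc k = gsrc l.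
      have : gtgt (at_src ab (gsrc k)) =
        gtgt (at_src ab (gsrc l)) by rewrite -s1 -s2 -/(psi k) e.
      move=> /= /(strcat_inj erefl)[_ tk].
      rewrite -(strcat_xtake (gsrc k) (size ab.1)) -(strcat_xtake (gsrc l)
        (size ab.1)).
      by rewrite (eqP stk) (eqP stl) tk.
    apply: (ldiv_inj (g := at_src ab (gsrc k))); rewrite ?at_src_src//.
    by rewrite {2}sE.
  apply: (@le_trans _ _ (M ^+ 2 * sqsum x (psi @` S')%fset)); last first.
    by rewrite exprMn ler_wpM2l ?exprn_ge0//; exact: sqsum_le_norm.
  rewrite /sqsum big_imfset//= big_fset/= mulr_sumr.
  rewrite [leRHS]big_mkcond /=; apply: ler_sum => l _.
  rewrite (conv_elem _ _ fab); case: ifP => _; last by rewrite normr0 expr0n.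
  by rewrite normrM exprMn ler_wpM2r ?exprn_ge0// ler_pXn2r ?nnegrE.
have mem : conv f x \in @ell2_pred R G by apply/ell2P; exists ((M * `|x|) ^+ 2).
exists (Ell2 mem); split=> //; apply: ell2_norm_le => //.
by rewrite mulr_ge0.
Qed.

Lemma Cc_bounded f : Cc f -> exists M, conv_bounded f M.
Proof.
move: f; apply: Cc_ind => [ab f|f1 f2 C1 C2 [M1 [M10 h1]] [M2 [M20 h2]]].
  exact: conv_bounded_elem.
exists (M1 + M2); split; first exact: addr_ge0.
move=> x; have [y1 [y1E y1M]] := h1 x; have [y2 [y2E y2M]] := h2 x.
exists (y1 + y2); split.
  move=> l; rewrite conv_combl; [|exact: Cc_fincover|exact: Cc_fincover].
  by rewrite ell2DE y1E y2E scale1r.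
by rewrite mulrDl (le_trans (ler_normD _ _))// lerD.
Qed.

Section Op.
Variables (f : G -> C) (Hf : Cc f).

Lemma conv_op_mem (x : H) : conv f x \in @ell2_pred R G.
Proof.
have [M [_ /(_ x)[y [yE _]]]] := Cc_bounded Hf.
by rewrite (_ : conv f x = y) ?ell2_mem//; apply/funext => l; rewrite yE.
Qed.

Definition conv_op (x : H) : H := Ell2 (conv_op_mem x).

Lemma conv_op_linear : linear conv_op.
Proof.
move=> a x y; apply: ell2_ext => l /=.
have := @conv_combr R n a f x y (Cc_fincover Hf).
by move=> /(congr1 (fun F => F l)).
Qed.

HB.instance Definition _ := GRing.isLinear.Build C H H *:%R conv_op
  conv_op_linear.

Lemma conv_op_bounded : exists M, 0 <= M /\ forall x, `|conv_op x| <= M * `|x|.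
Proof.
have [M [M0 h]] := Cc_bounded Hf; exists M; split=> // x.
have [y [yE yM]] := h x; suff -> : conv_op x = y by [].
by apply: ell2_ext => l; rewrite yE.
Qed.

End Op.

(** A representation is a total map, while [conv_op] needs a proof of Cc f. *)
Definition regrep (f : G -> C) : {linear H -> H} :=
  match pselect (Cc f) with
  | left Hf => conv_op Hf
  | right _ => \0
  end.

Lemma regrepE f x l : Cc f -> regrep f x l = conv f x l.
Proof. by rewrite /regrep; case: pselect. Qed.

Lemma regrep_bounded f : Cc f -> exists M, 0 <= M /\ forall x,
  `|regrep f x| <= M * `|x|.
Proof. by rewrite /regrep; case: pselect => // Hf _; exact: conv_op_bounded.
Qed.

Lemma bounded_continuous (T : {linear H -> H}) (M : C) : 0 <= M ->
  (forall x, `|T x| <= M * `|x|) -> continuous T.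
Proof.
move=> M0 TM x; have FF : Filter (nbhs x) by exact: nbhs_filter.
apply/(@cvgrPdist_lt _ _ _ (nbhs x)) => e e0.
have M1 : 0 < M + 1 by rewrite ltr_wpDl.
have eM : 0 < e / (M + 1) by rewrite divr_gt0.
have /(@cvgrPdist_lt _ _ _ (nbhs x)) /(_ _ eM) :
  id @ nbhs x --> x by exact: cvg_id.
apply: filterS => y /= xy; rewrite -linearB (le_lt_trans (TM _))//.
rewrite (@le_lt_trans _ _ ((M + 1) * `|x - y|))//.
  by rewrite ler_wpM2r// lerDl.
by rewrite mulrC -ltr_pdivlMr.
Qed.

(** Multiplicativity is the associativity of the convolution, and adjointness is
    read off the matrices given by [conv_delta]. *)
Lemma regrep_star : is_star_rep (H := ell2_hilbert R G) regrep.
Proof.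
split.
- move=> f Cf; have [M [M0 fM]] := regrep_bounded Cf.
  exact: (bounded_continuous M0 fM).
- move=> c f1 f2 C1 C2 v; apply: ell2_ext => l.
  rewrite regrepE; last exact: Cc_comb.
  rewrite conv_combl; [|exact: Cc_fincover|exact: Cc_fincover].
  by rewrite [RHS](_ : _ = c * regrep f1 v l + regrep f2 v l)// !regrepE.
- move=> f1 f2 C1 C2 v; apply: ell2_ext => l.
  rewrite regrepE; last exact: Cc_conv.
  rewrite conv_assoc// regrepE//; congr (conv f1 _ l).
  by apply/funext => k; rewrite regrepE.
- move=> f Cf v w; have Cf' := Cc_invol Cf.
  have [M [M0 fM]] := regrep_bounded Cf;
    have [M' [M0' fM']] := regrep_bounded Cf'.
  apply: (adjoint_ext M0 M0' fM fM') => i j; rewrite !regrepE//.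
  rewrite [LHS](conv_delta f j i) [X in X^*](conv_delta (invol f) i j).
  have -> : (gtgt j = gtgt i) = (gtgt i = gtgt j) by apply/propext; split.
  case: asboolP => [tij|]; last by rewrite conjC0.
  rewrite /invol conjCK; congr f.
  have e : gsrc (ginv i) = gsrc (ginv j) by [].
  have [s d t] := ldivP e; have [s' d' t'] := ldivP (esym e).
  by apply: gext; rewrite /= ?s ?d ?t ?s' ?d' ?t' //=; lia.
Qed.

End Representation.

Section Bessel.
Variables (R : realType) (n : nat).
Local Notation C := (Cplx R).
Local Notation G := (cuntzGroupoid n).
Variables (On : cstarAlgType C) (iota : (G -> C) -> On).
Hypothesis hOn : is_groupoid_cstar iota.

Lemma regrep_le_norm f (x : ell2 R G) : Cc f -> `|x| <= 1 ->
  `|regrep f x| <= `|iota f|.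
Proof.
move=> Cf x1; have [_ _ _ hn _] := hOn.
have : ((rnorm (regrep f x : ell2_hilbert R G))%:E <= (rnorm (iota f))%:E)%E.
  rewrite hn//; apply: (@le_trans _ _ (opnorm (H :=
    ell2_hilbert R G) (regrep f))).
    apply: ereal_sup_ubound; exists x => //.
    by rewrite /= -(toC_le (R := R)) toC_Re.
  by apply: ereal_sup_ubound; exists (ell2_hilbert R G), (@regrep R n);
    split=> //; exact: regrep_star.
by rewrite lee_fin -(toC_le (R := R)) !toC_Re.
Qed.

(** The left-hand side is a partial sum of the squared norm of the image of the
    basis vector at the unit y. *)
Lemma bessel_tgt f (S : {fset G}) y : Cc f -> (forall g, g \in S ->
  gtgt g = y) ->
  \sum_(g <- S) `|f g| ^+ 2 <= `|iota f| ^+ 2.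
Proof.
move=> Cf Sy; pose u := gunit y.
have u1 : `|edelta R u| <= 1.
  apply: ell2_norm_le => // T; rewrite expr1n /sqsum.
  rewrite (eq_bigr (fun j => (if j == u then 1 else 0) : C)); last first.
    by move=> j _ /=; case: eqP; rewrite ?normr1 ?normr0 ?expr1n ?expr0n.
  by rewrite -big_mkcond /= sum_pred1_seq ?fset_uniq//; case: ifP.
apply: (@le_trans _ _ (`|regrep f (edelta R u)| ^+ 2)); last first.
  by rewrite ler_pXn2r ?nnegrE//; exact: regrep_le_norm.
apply: le_trans (sqsum_le_norm _ S); rewrite /sqsum.
rewrite big_seq [leRHS]big_seq; apply: ler_sum => g gS.
rewrite regrepE// (conv_delta f u g) asboolT /=; last by rewrite Sy.
suff -> : ldiv (ginv g) (ginv u) = g by [].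
have e : gsrc (ginv g) = gsrc (ginv u) by rewrite /= Sy.
have [s d t] := ldivP e; apply: gext; rewrite ?s ?d ?t//=; lia.
Qed.

End Bessel.

(** * Elements of the algebra as functions *)

Section CstarNorm.
Variables (K : numClosedFieldType) (A : cstarAlgType K).

Lemma cstar_norm (a : A) : `|cstar a| = `|a|.
Proof.
have le (b : A) : `|b| <= `|cstar b|.
  have [->|b0] := eqVneq b 0; first by rewrite normr0.
  rewrite -(@ler_pM2r _ `|b|) ?normr_gt0// -expr2 -cnorm_starM.
  exact: cnormM.
by apply/eqP; rewrite eq_le le andbT -[in leRHS](cstarK a) le.
Qed.

Lemma cstarB (a b : A) : cstar (a - b) = cstar a - cstar b.
Proof. by rewrite -scaleN1r cstarD cstarZ rmorphN /= conjC1 scaleN1r. Qed.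

Lemma cmulBl (a b c : A) : cmul (a - b) c = cmul a c - cmul b c.
Proof. by rewrite -scaleN1r cmulDl cmulZl scaleN1r. Qed.

Lemma cmulBr (a b c : A) : cmul c (a - b) = cmul c a - cmul c b.
Proof. by rewrite -scaleN1r cmulDr cmulZr scaleN1r. Qed.

End CstarNorm.

Section FunOf.
Variables (R : realType) (n : nat).
Local Notation C := (Cplx R).
Local Notation G := (cuntzGroupoid n).
Variables (On : cstarAlgType C) (iota : (G -> C) -> On).
Hypothesis hOn : is_groupoid_cstar iota.
Local Notation ev := (fun_of iota).
Implicit Types (f : G -> C) (g : G) (a b : On).

Lemma iotaB f1 f2 : Cc f1 -> Cc f2 -> iota (f1 - f2) = iota f1 - iota f2.
Proof.
move=> C1 C2; have [lin _ _ _ _] := hOn.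
by rewrite addrC -scaleN1r lin// scaleN1r addrC.
Qed.

Lemma Cc_sub f1 f2 : Cc f1 -> Cc f2 -> Cc (f1 - f2).
Proof. by move=> C1 C2; rewrite addrC -scaleN1r; exact: Cc_comb. Qed.

Lemma sup_le_norm f g : Cc f -> `|f g| <= `|iota f|.
Proof.
move=> Cf; rewrite -(@ler_pXn2r _ 2) ?nnegrE//.
have := @bessel_tgt R n On iota hOn f [fset g]%fset (gtgt g) Cf.
by rewrite big_seq_fset1; apply=> h; rewrite inE => /eqP ->.
Qed.

Lemma iota_dense (a : On) (e : C) : 0 < e ->
  exists f, Cc f /\ `|a - iota f| < e.
Proof.
move=> e0; have [_ _ _ _ cl] := hOn.
have : closure (iota @` @Cc R n) a by rewrite cl.
move=> /(_ (ball a e) (nbhsx_ballx _ _ e0)) [_ [[f Cf <-]]].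
by rewrite -ball_normE => af; exists f.
Qed.

Lemma le_eps_eq0 (x K : C) : 0 <= x -> 0 <= K -> (forall e, 0 < e ->
  x <= e * K) -> x = 0.
Proof.
move=> x0 K0 h; apply/eqP; rewrite eq_le x0 andbT; apply/ler_addgt0Pl => e e0.
have K1 : 0 < K + 1 by rewrite ltr_wpDl.
rewrite addr0 (le_trans (h _ (divr_gt0 e0 K1)))//.
by rewrite mulrAC -mulrA ler_piMr ?(ltW e0)// ler_pdivrMr// mul1r lerDl.
Qed.

(** The filter of the functions f in C_c(G_n) with iota f tending to a; by
    definition fun_of iota a g is the limit of f g along it. *)
Definition approx a : set_system (G -> C) :=
  [set P | \forall b \near a, forall f, Cc f -> iota f = b -> P f].

#[local] Instance approx_filter a : ProperFilter (approx a).
Proof.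
apply: Build_ProperFilter_ex.
  move=> P FP; have [e e0 he] := (nbhs_ballP _ _).1 FP.
  have [h [Ch ah]] := iota_dense a e0.
  by exists h; apply: (he (iota h)) => //; rewrite -ball_normE.
split.
- by apply: nearW => b f' _ _.
- move=> P Q FP FQ.
  apply: (@filterS _ (nbhs a) _ _ _ _ (@filterI _ (nbhs a) _ _ _ FP FQ)) => b
    [hP hQ] h Ch hb.
  by split; [exact: hP|exact: hQ].
- move=> P Q PQ FP; apply: (@filterS _ (nbhs a) _ _ _ _ FP) => b hP h Ch hb.
  exact/PQ/hP.
Qed.

Lemma approx_near a (e : C) : 0 < e ->
  approx a [set f | Cc f /\ `|a - iota f| < e].
Proof.
move=> e0; apply: filterS (nbhsx_ballx a _ e0) => b;
  rewrite -ball_normE /= => ab f Cf fb.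
by rewrite fb.
Qed.

(** The values f g are Cauchy along [approx a] because evaluation at g is
    contractive on C_c(G_n). *)
Lemma fun_of_approx a f g : Cc f -> `|ev a g - f g| <= `|a - iota f|.
Proof.
move=> Cf; pose F : set_system C := (fun f => f g) @ approx a.
have Fnear (h : G -> C) (e : C) : Cc h -> `|a - iota h| < e ->
  F [set z | `|h g - z| < e].
  move=> Ch ahe.
  have d0 : 0 < e - `|a - iota h| by rewrite subr_gt0.
  change (approx a [set f | `|h g - f g| < e]).
  apply: filterS (approx_near a d0) => k /= [Ck ak].
  apply: (@le_lt_trans _ _ `|iota h - iota k|).
    by rewrite -iotaB//; have := @sup_le_norm (h - k) g; apply; exact: Cc_sub.
  by rewrite (le_lt_trans (ler_distD a _ _))// distrC addrC -ltrBrDr.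
have [l Fl] : exists l : C, F --> l.
  apply: complex_cauchy => e e0; have [h [Ch ah]] := iota_dense a e0.
  by exists (h g); exact: Fnear.
have -> : ev a g = l by exact: (@cvg_lim _ (@norm_hausdorff _ _) _ _ _ (fun f
  => f g) l Fl).
apply/ler_addgt0Pl => e e0.
have e2 : 0 < e / 2 by rewrite divr_gt0.
have Fl' : F [set z | `|l - z| < e / 2].
  by apply: Fl; rewrite (_ : [set z | _] = ball l (e / 2)) ?ball_normE//;
    exact: nbhsx_ballx.
have Ff : F [set z | `|f g - z| < `|a - iota f| + e / 2].
  by apply: Fnear => //; rewrite ltrDl.
have [z [/= lz fz]] := filter_ex (filterI Fl' Ff).
rewrite (le_trans (ler_distD z _ _))// (distrC z (f g)).
by rewrite (le_trans (lerD (ltW lz) (ltW fz)))// addrCA -splitr addrC.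
Qed.

Lemma fun_of_iota f g : Cc f -> ev (iota f) g = f g.
Proof.
move=> Cf; apply/eqP; rewrite -subr_eq0 -normr_le0.
by have := fun_of_approx (iota f) g Cf; rewrite subrr normr0.
Qed.

(** The way in which identities are transported from C_c(G_n) to the algebra. *)
Lemma fun_of_unique a g (z K : C) : 0 <= K ->
  (forall e, 0 < e -> exists f, [/\ Cc f,
    `|a - iota f| <= e * K & `|z - f g| <= e * K]) ->
  z = ev a g.
Proof.
move=> K0 h; apply/eqP; rewrite -subr_eq0 -normr_eq0; apply/eqP.
apply: (@le_eps_eq0 _ (K + K)); rewrite ?addr_ge0// => e e0.
have [f [Cf af zf]] := h e e0.
rewrite (le_trans (ler_distD (f g) _ _))// mulrDr lerD// distrC.
exact: le_trans (fun_of_approx _ _ Cf) af.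
Qed.

Lemma fun_of_lin (c : C) a b g : ev (c *: a + b) g = c * ev a g + ev b g.
Proof.
have [lin _ _ _ _] := hOn.
apply/esym/(@fun_of_unique _ _ _ (`|c| + 1)); first by rewrite addr_ge0.
move=> e e0; have [f1 [C1 af]] := iota_dense a e0;
  have [f2 [C2 bf]] := iota_dense b e0.
exists (c *: f1 + f2); split; first exact: Cc_comb.
- rewrite lin// opprD addrACA -scalerBr (le_trans (ler_normD _ _))// normrZ.
  by rewrite mulrDr mulr1 lerD ?(ltW bf)// mulrC ler_wpM2r// ltW.
- rewrite (_ : (c *: f1 + f2) g = c * f1 g + f2 g)// opprD addrACA -mulrBr.
  rewrite (le_trans (ler_normD _ _))// normrM mulrDr mulr1 lerD//.
    rewrite mulrC ler_wpM2r//; exact: le_trans (fun_of_approx _ _ C1) (ltW af).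
  exact: le_trans (fun_of_approx _ _ C2) (ltW bf).
Qed.

Lemma fun_of0 g : ev 0 g = 0.
Proof. by have := fun_of_lin (-1) 0 0 g; rewrite scaler0 addr0 mulN1r addNr.
Qed.

Lemma fun_ofB a b g : ev (a - b) g = ev a g - ev b g.
Proof. by rewrite addrC -scaleN1r fun_of_lin mulN1r addrC. Qed.

Lemma Cc0 : Cc (0 : G -> C).
Proof.
apply: (@Cc_elem _ _ ([::], [::])); first exact: cst_continuous.
by move=> g; rewrite (_ : (0 : G -> C) g = 0)// eqxx.
Qed.

Lemma iota0 : iota 0 = 0.
Proof. by have := iotaB Cc0 Cc0; rewrite !subrr. Qed.

Lemma fun_of_le_norm a g : `|ev a g| <= `|a|.
Proof.
have := fun_of_approx a g Cc0; rewrite iota0 [a - 0]subr0.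
by rewrite [X in `|_ - X|](_ : _ = 0)// subr0.
Qed.

Lemma fun_of_star a g : ev (cstar a) g = (ev a (ginv g))^*.
Proof.
have [_ _ st _ _] := hOn; apply/esym/(@fun_of_unique _ _ _ 1) => // e e0.
have [f [Cf af]] := iota_dense a e0; exists (invol f); rewrite mulr1.
split; first exact: Cc_invol.
- by rewrite st// -cstarB cstar_norm ltW.
- rewrite /invol -rmorphB norm_conjC.
  exact: le_trans (fun_of_approx _ _ Cf) (ltW af).
Qed.

(** A uniform limit of continuous functions. *)
Lemma fun_of_continuous a : continuous (ev a).
Proof.
move=> g; have FF : Filter (nbhs g) by exact: nbhs_filter.
apply/(@cvgrPdist_lt _ _ _ (nbhs g)) => e e0.
have e3 : 0 < e / 3 by rewrite divr_gt0.
have [f [Cf af]] := iota_dense a e3.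
have fc : {for g, continuous f} by have [fc _] := (CcP f).1 Cf; exact: fc.
have /(@cvgrPdist_lt _ _ _ (nbhs g)) /(_ _ e3) := fc.
apply: filterS => h /= fgh.
have -> : e = e / 3 + (e / 3 + e / 3) by field.
rewrite (le_lt_trans (ler_distD (f g) _ _))// ler_ltD//.
  exact: le_trans (fun_of_approx _ _ Cf) (ltW af).
rewrite (le_lt_trans (ler_distD (f h) _ _))// ltr_leD// distrC.
exact: le_trans (fun_of_approx _ _ Cf) (ltW af).
Qed.

Lemma fun_of_cvg a g : (fun f => f g) @ approx a --> ev a g.
Proof.
apply/cvgrPdist_lt => e e0; apply: filterS (approx_near a e0) => f /= [Cf af].
exact: le_lt_trans (fun_of_approx _ _ Cf) af.
Qed.

(** [bessel_tgt] in the limit. *)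
Lemma fun_of_bessel a (r : seq G) y : uniq r -> (forall g, g \in r ->
  gtgt g = y) ->
  \sum_(g <- r) `|ev a g| ^+ 2 <= `|a| ^+ 2.
Proof.
move=> ur ry.
have fb f : Cc f -> \sum_(g <- r) `|f g| ^+ 2 <= `|iota f| ^+ 2.
  move=> Cf; have := @bessel_tgt R n On iota hOn f [fset g in r]%fset y Cf.
  rewrite (perm_big r) /=; last first.
    by apply: uniq_perm => [||g]; rewrite ?fset_uniq ?inE.
  by apply=> g; rewrite !inE; exact: ry.
have sc : (fun f : G -> C => \sum_(g <- r) `|f g| ^+ 2) @ approx a -->
  \sum_(g <- r) `|ev a g| ^+ 2.
  apply: (@sum_cvg R G _ _ r (fun g f => `|f g| ^+ 2) (fun g => `|ev a g| ^+
    2)) => g.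
  have h : `|f g| @[f --> approx a] --> `|ev a g| by apply: cvg_norm;
    exact: fun_of_cvg.
  under eq_fun do rewrite expr2.
  rewrite expr2; exact: (cvgM h h).
have s0 : 0 <= \sum_(g <- r) `|ev a g| ^+ 2 by apply: sumr_ge0 => g _;
  rewrite exprn_ge0.
rewrite -[leLHS]sqrtCK ler_pXn2r ?nnegrE ?sqrtC_ge0//.
apply/ler_addgt0Pl => e e0.
rewrite -(@ler_pXn2r _ 2) ?nnegrE ?sqrtC_ge0 ?addr_ge0 ?(ltW e0)// sqrtCK.
apply: (complex_cvg_le sc); rewrite ?exprn_ge0 ?addr_ge0 ?(ltW e0)//.
apply: filterS (approx_near a e0) => f [Cf af].
rewrite sumr_ge0/= => [|g _]; last by rewrite exprn_ge0.
rewrite (le_trans (fb _ Cf))// ler_pXn2r ?nnegrE ?addr_ge0 ?(ltW e0)//.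
rewrite -[iota f](subrK a) (le_trans (ler_normD _ _))// lerD2r.
by rewrite distrC ltW.
Qed.

(** The adjoint exchanges rows and columns. *)
Lemma fun_of_bessel_src a (r : seq G) x : uniq r -> (forall g, g \in r ->
  gsrc g = x) ->
  \sum_(g <- r) `|ev a g| ^+ 2 <= `|a| ^+ 2.
Proof.
move=> ur rx; rewrite -(cstar_norm a).
have := @fun_of_bessel (cstar a) [seq ginv g | g <- r] x.
have ginvK : involutive (@ginv n).
  by move=> g; apply: gext => //=; rewrite opprK.
rewrite big_map map_inj_uniq; last exact: (can_inj ginvK).
under eq_bigr do rewrite fun_of_star ginvK norm_conjC.
by apply=> // g /mapP[h hr ->]; exact: rx.
Qed.

(** The sum is finite and both sides are continuous in b, so it is enough to
    know the formula for b in the image of C_c(G_n). *)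
Lemma fun_of_cmul f b l (r : seq G) : Cc f -> uniq r ->
  (forall g, g \in r -> gsrc g = gsrc l) ->
  (forall g, gsrc g = gsrc l -> f g != 0 -> g \in r) ->
  ev (cmul (iota f) b) l = \sum_(g <- r) f g * ev b (ldiv g l).
Proof.
move=> Cf ur rl mr; have [_ mul _ _ _] := hOn.
apply/esym; pose K := \sum_(g <- r) `|f g|.
have K0 : 0 <= K by apply: sumr_ge0.
apply: (@fun_of_unique _ _ _ (`|iota f| + K)); first by rewrite addr_ge0.
move=> e e0; have [h [Ch bh]] := iota_dense b e0.
exists (conv f h); split; first exact: Cc_conv.
- rewrite mul// -cmulBr (le_trans (cnormM _ _))// mulrC.
  by rewrite ler_pM ?(ltW bh)// lerDl.
- rewrite (conv_seq h ur rl mr) -sumrB (le_trans (ler_norm_sum _ _ _))//.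
  rewrite (@le_trans _ _ (e * K))//;
    last by rewrite ler_wpM2l ?(ltW e0)// lerDr.
  rewrite mulr_sumr; apply: ler_sum => g _; rewrite -mulrBr normrM mulrC.
  by rewrite ler_wpM2r// (le_trans (fun_of_approx _ _ Ch))// ltW.
Qed.

End FunOf.

(** * Triangularity and maximality of A(P_V) *)

Section Main.
Variables (R : realType) (n : nat).
Hypothesis n2 : (2 <= n)%N.
Local Notation C := (Cplx R).
Local Notation G := (cuntzGroupoid n).
Variables (On : cstarAlgType C) (iota : (G -> C) -> On).
Hypothesis hOn : is_groupoid_cstar iota.
Local Notation ev := (fun_of iota).
Local Notation A := (A_of iota).
Implicit Types (f : G -> C) (g : G) (a b : On) (P : set G).

(** Summed over a finite set with a small e, this bounds a sum of products when
    the first factors have square sum at most e ^+ 2. *)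
Lemma norm_mul_le (x y e : C) : 0 < e ->
  `|x * y| <= e^-1 * `|x| ^+ 2 + e * `|y| ^+ 2.
Proof.
move=> e0; have ne : e != 0 by rewrite gt_eqF.
have h : 0 <= e^-1 * (`|x| - e * `|y|) ^+ 2.
  rewrite mulr_ge0 ?invr_ge0 ?(ltW e0)// real_exprn_even_ge0//.
  by rewrite rpredB ?rpredM ?normr_real// ger0_real// ltW.
rewrite normrM -subr_ge0.
have -> : e^-1 * `|x| ^+ 2 + e * `|y| ^+ 2 - `|x| * `|y| =
   `|x| * `|y| + e^-1 * (`|x| - e * `|y|) ^+ 2 by field.
by apply: addr_ge0 => //; rewrite mulr_ge0.
Qed.

(** Replace a by f in C_c(G_n) with norm of a - iota f below e.  In the convolution
    of f and fun_of iota b at l outside P, a term with nonzero second factor has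
    its first factor at a point outside P, where fun_of iota a vanishes; hence f
    may be replaced by f - fun_of iota a, a row of norm at most e. *)
Lemma A_of_cmul P a b : (forall g h l, gprod g h l -> P g -> P h -> P l) ->
  A P a -> A P b -> A P (cmul a b).
Proof.
move=> Pmul Aa Ab l nPl.
apply/eqP; rewrite -normr_eq0; apply/eqP.
apply: (@le_eps_eq0 _ _ (1 + `|b| ^+ 2 + `|b|));
  rewrite ?addr_ge0 ?exprn_ge0// => e e0.
have [f [Cf af]] := iota_dense hOn a e0.
have [r [ur rl mr]] := fibre_seq (Cc_fincover Cf) (gsrc l).
rewrite -[ev _ l](subrK (ev (cmul (iota f) b) l)) (le_trans (ler_normD _ _))//.
rewrite addrC !mulrDr lerD//; last first.
  rewrite -fun_ofB// -cmulBl (le_trans (fun_of_le_norm hOn _ _))// (le_trans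
    (cnormM _ _))//.
  by rewrite ler_wpM2r// ltW.
rewrite (fun_of_cmul hOn b Cf ur rl mr) (le_trans (ler_norm_sum _ _ _))//.
have term g : g \in r -> f g * ev b (ldiv g l) =
  ev (iota f - a) g * ev b (ldiv g l).
  move=> gr; rewrite fun_ofB// fun_of_iota// mulrBl.
  have [->|evb] := eqVneq (ev b (ldiv g l)) 0; first by rewrite !mulr0 subr0.
  rewrite Aa ?mul0r ?subr0// => Pg; apply: nPl.
  apply: (Pmul g (ldiv g l)) => //; first by apply/gprodP; split=> //;
    exact: rl.
  by apply: contrapT => /Ab h0; rewrite h0 eqxx in evb.
rewrite big_seq; apply: (@le_trans _ _ (\sum_(g <- r | g \in r)
   (e^-1 * `|ev (iota f - a) g| ^+ 2 + e * `|ev b (ldiv g l)| ^+ 2))).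
  by apply: ler_sum => g gr; rewrite term// norm_mul_le.
rewrite -big_seq big_split -!mulr_sumr /=; apply: lerD.
  rewrite mulr1 -ler_pdivlMl ?invr_gt0// invrK -expr2.
  rewrite (le_trans (fun_of_bessel_src hOn _ ur rl))// ler_pXn2r ?nnegrE ?(ltW
    e0)//.
  by rewrite distrC ltW.
rewrite ler_wpM2l ?(ltW e0)//.
have := @fun_of_bessel R n On iota hOn b [seq ldiv g l | g <- r] (gtgt l).
rewrite big_map; apply.
  rewrite map_inj_in_uniq// => g h gr hr e1.
  have [s1 d1 t1] := ldivP (rl _ gr); have [s2 d2 t2] := ldivP (rl _ hr).
  apply: gext; first by rewrite !rl.
    by move: d1; rewrite e1 d2; lia.
  by rewrite -s1 e1.
by move=> _ /mapP[g gr ->]; have [] := ldivP (rl _ gr).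
Qed.

Lemma A_of_closed P : closed (A P).
Proof.
move=> a cla g nPg; apply/eqP; rewrite -normr_eq0; apply/eqP.
apply: (@le_eps_eq0 _ _ 1) => // e e0; rewrite mulr1.
have [b [Ab]] := cla (ball a e) (nbhsx_ballx _ _ e0).
rewrite -ball_normE /= => ab.
by rewrite -[ev a g]subr0 -(Ab _ nPg) -fun_ofB// (le_trans (fun_of_le_norm hOn
  _ _))// ltW.
Qed.

Lemma A_of_subalgebra P : (forall g h l, gprod g h l -> P g -> P h -> P l) ->
  closed_subalgebra (A P).
Proof.
move=> Pmul; split.
- by move=> g _; rewrite fun_of0.
- by move=> c a b Aa Ab g nPg; rewrite fun_of_lin// Aa// Ab// mulr0 addr0.
- by move=> a b; exact: A_of_cmul.
- exact: A_of_closed.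
Qed.

Lemma A_of_P_V_triangular : triangular iota (A (@P_V n)).
Proof.
split; first by apply: A_of_subalgebra => g h l; exact: P_V_prod.
apply/seteqP; split=> [a [Aa [b Ab ba]] g nD|a Aa].
  apply: contrapT => ag; apply: nD; apply: P_V_inv => //.
    by apply: contrapT => /Aa.
  apply: contrapT => /Ab h; apply: ag.
  by rewrite -ba fun_of_star// h conjC0.
split=> [g nP|]; first by apply: Aa => /D0_P_V.
exists (cstar a); last exact: cstarK.
move=> g nP; rewrite fun_of_star// Aa ?conjC0// => /D0_inv.
rewrite [ginv _](_ : _ = g); last by apply: gext => //=; rewrite opprK.
by move/D0_P_V.
Qed.

Definition chi (s : seq 'I_n) : G -> C := cutoff (s, s) (fun=> 1).

Lemma chi_supp s : supp_in (s, s) (chi s). Proof. exact: cutoff_supp. Qed.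

Lemma chi_Cc s : Cc (chi s).
Proof.
by apply: (@Cc_elem _ _ (s, s)); [apply: cutoff_continuous;
  exact: cst_continuous|exact: chi_supp].
Qed.

Lemma basicU_D0 s g : basicU (s, s) g -> D0 g.
Proof. by move=> [c [/= sg dg tg]]; split; rewrite ?dg ?subrr// sg tg. Qed.

Lemma iota_chi_D0 s : A (@D0 n) (iota (chi s)).
Proof.
move=> g nD; rewrite fun_of_iota//; last exact: chi_Cc.
by rewrite /chi /cutoff asboolF// => /basicU_D0.
Qed.

(** Multiplication by chi s on the left restricts the function to the points whose
    source starts with s; the adjoint gives the analogue for the target. *)
Lemma fun_of_chi_mul s a l :
  ev (cmul (iota (chi s)) a) l = if starts s (gsrc l) then ev a l else 0.
Proof.
case: ifPn => st; last first.
  rewrite (@fun_of_cmul _ _ _ _ hOn _ _ _ [::] (chi_Cc s))// ?big_nil// => g gl.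
  by move=> /chi_supp/basicU_at_src[]; rewrite gl (negbTE st).
set u := at_src (s, s) (gsrc l).
have su : gsrc u = gsrc l by exact: at_src_src.
rewrite (@fun_of_cmul _ _ _ _ hOn _ _ _ [:: u] (chi_Cc s))//.
- rewrite big_seq1 /chi /cutoff asboolT ?mul1r; last exact: at_src_basicU.
  congr (ev a _); have [s1 d1 t1] := ldivP su; apply: gext; rewrite ?s1 ?t1//.
  by rewrite d1 /= subrr subr0.
- by move=> g; rewrite inE => /eqP ->.
- by move=> g gl /chi_supp/basicU_at_src[_ ->]; rewrite gl inE.
Qed.

Lemma fun_of_mul_chi s a l :
  ev (cmul a (cstar (iota (chi s)))) l =
    if starts s (gtgt l) then ev a l else 0.
Proof.
rewrite -[a in LHS]cstarK -cstarM fun_of_star// fun_of_chi_mul/= fun_of_star//.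
case: ifP => _; last by rewrite conjC0.
by rewrite conjCK; congr (ev a _); apply: gext => //=; rewrite opprK.
Qed.

(** The compression b of a lies in T, and its adjoint lies in A(P_V) since the
    source of a point in its support is smaller than the target.  So b is in the
    diagonal. *)
Lemma A_of_P_V_maximal T : triangular iota T -> A (@P_V n) `<=` T ->
  T = A (@P_V n).
Proof.
move=> [[_ _ Tmul _] Tdiag] AT; apply/seteqP; split=> // a Ta g nP.
apply: contrapT => /eqP ag.
have nb : nbhs g [set h | ev a h != 0].
  have FF : Filter (nbhs g) by exact: nbhs_filter.
  exact: (@cvgr_neq0 _ _ _ (nbhs g) FF _ _ (@fun_of_continuous R n On iota hOn
    a g) ag).
have [l [/= al [m [eqm ltm]]]] := P_V_compl_dense n2 nP nb.
pose s := xtake (gsrc l) m.+1; pose t := xtake (gtgt l) m.+1.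
have sl : starts s (gsrc l) by rewrite /starts /s size_xtake.
have tl : starts t (gtgt l) by rewrite /starts /t size_xtake.
have TD0 : A (@D0 n) `<=` T by rewrite -Tdiag => b [].
have TD0s : A (@D0 n) `<=` (@cstar _ On @` T) by rewrite -Tdiag => b [].
pose b := cmul (iota (chi s)) (cmul a (cstar (iota (chi t)))).
have Tb : T b.
  apply: (Tmul); first exact/TD0/iota_chi_D0.
  apply: Tmul => //; have [q Tq <-] := TD0s _ (iota_chi_D0 t).
  by rewrite cstarK.
have evb k : ev b k = if starts s (gsrc k) && starts t (gtgt k) then ev a k
  else 0.
  by rewrite fun_of_chi_mul fun_of_mul_chi; case: ifP.
have Asb : A (@P_V n) (cstar b).
  move=> k nPk; rewrite fun_of_star// evb /=; case: ifPn => [/andP[st tt]|];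
    last by rewrite conjC0.
  case: nPk; apply/P_VP; left; exists m.
  have e1 i : (i <= m)%N -> gtgt k i = gsrc l i.
    move=> im; have /xtake_eqP : xtake (gtgt k) m.+1 = xtake (gsrc l) m.+1.
      by move: st => /eqP; rewrite size_xtake.
    by apply.
  have e2 i : (i <= m)%N -> gsrc k i = gtgt l i.
    move=> im; have /xtake_eqP : xtake (gsrc k) m.+1 = xtake (gtgt l) m.+1.
      by move: tt => /eqP; rewrite size_xtake.
    by apply.
  split=> [i im|]; last by rewrite e1// e2.
  by rewrite e1 ?e2 ?eqm// ltnW.
have : (T `&` (@cstar _ On @` T)) b.
  by split=> //; exists (cstar b); [exact: AT|exact: cstarK].
rewrite Tdiag => /(_ l); rewrite evb sl tl /= => h.
have : ev a l = 0.
  by apply: h => -[_ e]; rewrite e ltnn in ltm.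
by move/eqP; rewrite (negbTE al).
Qed.

End Main.

Theorem proposition7 (R : realType) (n : nat) (hn : (2 <= n)%N)
  (On : cstarAlgType (Cplx R)) (iota : (cuntzGroupoid n -> Cplx R) -> On)
  (hOn : is_groupoid_cstar iota) :
  maximal_triangular iota (A_of iota (@P_V n)).
Proof.
split; first exact: A_of_P_V_triangular.
exact: A_of_P_V_maximal.
Qed.
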